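(* Consider a statistical model $f_{\boldsymbol{\theta}}(\mathbf{y},\mathbf{v})$ satisfying regularity conditions (R1)--(R6) of the context, with extended log-likelihood $\ell_e(\boldsymbol{\theta},\mathbf{v})$ and h-likelihood $h(\boldsymbol{\theta},\mathbf{v})=\ell_e(\boldsymbol{\theta},\mathbf{v})-\ell_e(\boldsymbol{\theta},\widetilde{\mathbf{v}})+\ell(\boldsymbol{\theta};\mathbf{y})$, where $\widetilde{\mathbf{v}}=\widetilde{\mathbf{v}}(\boldsymbol{\theta})=\arg\max_{\mathbf{v}}h(\boldsymbol{\theta},\mathbf{v})=\arg\max_{\mathbf{v}}\ell_e(\boldsymbol{\theta},\mathbf{v})$. Let $q(\cdot)$ be an arbitrary probability density function having the same support as $\mathbf{v}$, let $\mathbf{v}^{(1)},\dots,\mathbf{v}^{(B)}$ be independent samples from $q$, and define $$L_B(\boldsymbol{\theta};\mathbf{y})=\frac1B\sum_{b=1}^{B}\frac{L_e(\boldsymbol{\theta},\mathbf{v}^{(b)})}{q(\mathbf{v}^{(b)})},\qquad h_B(\boldsymbol{\theta},\mathbf{v})=\ell_e(\boldsymbol{\theta},\mathbf{v})-\ell_e(\boldsymbol{\theta},\widetilde{\mathbf{v}})+\log L_B(\boldsymbol{\theta};\mathbf{y}).$$ Suppose that $(\widehat{\boldsymbol{\theta}},\widehat{\mathbf{v}})$ are the MHLEs (joint maximizers of $h$) and $(\widehat{\boldsymbol{\theta}}_B,\widehat{\mathbf{v}}_B)$ are the approximate MHLEs (joint maximizers of $h_B$). Let $I(\boldsymbol{\theta},\mathbf{v})=-\nabla^2_{\boldsymbol{\theta},\mathbf{v}}h(\boldsymbol{\theta},\mathbf{v})$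 and let $I_B(\boldsymbol{\theta},\mathbf{v})=-\nabla^2_{\boldsymbol{\theta},\mathbf{v}}h_B(\boldsymbol{\theta},\mathbf{v})$ be the approximate h-information. Then, as $B\to\infty$, $$(\widehat{\boldsymbol{\theta}}_B,\widehat{\mathbf{v}}_B)\overset{p}{\to}(\widehat{\boldsymbol{\theta}},\widehat{\mathbf{v}})\quad\text{and}\quad I_B(\widehat{\boldsymbol{\theta}}_B,\widehat{\mathbf{v}}_B)\overset{p}{\to}I(\widehat{\boldsymbol{\theta}},\widehat{\mathbf{v}}).$$
   Context: Model: $f_{\boldsymbol{\theta}}(\mathbf{y},\mathbf{v})=f_{\boldsymbol{\theta}}(\mathbf{y}|\mathbf{v})f_{\boldsymbol{\theta}}(\mathbf{v})$ is the joint density of observed data $\mathbf{y}$ and continuous random unknowns $\mathbf{v}\in\Omega_{\mathbf{v}}$, with fixed unknowns $\boldsymbol{\theta}\in\boldsymbol{\Theta}\subseteq\mathbb{R}^p$. $L_e(\boldsymbol{\theta},\mathbf{v})=f_{\boldsymbol{\theta}}(\mathbf{y},\mathbf{v})$, $\ell_e=\log L_e$, $L(\boldsymbol{\theta};\mathbf{y})=f_{\boldsymbol{\theta}}(\mathbf{y})$ and $\ell(\boldsymbol{\theta};\mathbf{y})=\log L(\boldsymbol{\theta};\mathbf{y})$. Thus $h=\ell_e+a$ with $a(\boldsymbol{\theta};\mathbf{y})=-\log f_{\boldsymbol{\theta}}(\widetilde{\mathbf{v}}|\mathbf{y})$. The scale $\mathbf{v}$ is chosen Bartlizable, i.e. $\mathrm{E}[\nabla_{\boldsymbol{\theta},\mathbf{v}}h]=0$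 and $\mathrm{E}[(\nabla_{\boldsymbol{\theta},\mathbf{v}}h)(\nabla_{\boldsymbol{\theta},\mathbf{v}}h)^{\intercal}+\nabla^2_{\boldsymbol{\theta},\mathbf{v}}h]=0$ under the joint law of $(\mathbf{y},\mathbf{v})$. The convergence in probability is with respect to the Monte Carlo samples, the data $\mathbf{y}$ being given. Regularity conditions, for $h(\boldsymbol{\theta},\mathbf{v};\mathbf{y})$ and all the densities $f_{\boldsymbol{\theta}}(\mathbf{y})$, $f_{\boldsymbol{\theta}}(\mathbf{v})$, $f_{\boldsymbol{\theta}}(\mathbf{y}|\mathbf{v})$, $f_{\boldsymbol{\theta}}(\mathbf{v}|\mathbf{y})$: (R1) there exists an open set $\boldsymbol{\Theta}^{\ast}\subseteq\boldsymbol{\Theta}$ of which the true value is an interior point; (R2) supports are invariant to $\boldsymbol{\theta}$; (R3) continuously differentiable up to third order; (R4) integration and differentiation can be interchanged up to second order; (R5) the third derivatives are bounded by some integrable functions; (R6) the information matrices are positive definite.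
   Formalization: Added assumption: the approximate MHLEs are bounded in probability inside Θ*×Ω_v (up to small probability they lie in a compact subset for large B); without it a global maximizer of h_B can diverge. The MHLE is taken to be the unique joint maximizer of h. *)

(* Defs.v *)
From mathcomp Require Import all_boot all_order all_algebra.
From mathcomp Require Import all_classical all_reals all_analysis.

Set Implicit Arguments.
Unset Strict Implicit.
Unset Printing Implicit Defensive.

Import Order.TTheory GRing.Theory Num.Theory.
Import numFieldNormedType.Exports.

Local Open Scope classical_set_scope.
Local Open Scope ring_scope.

Definition partial (R : realType) (n : nat) (i : 'I_n) (F : 'rV[R]_n -> R) :
    'rV[R]_n -> R :=
  fun x => 'D_(delta_mx ord0 i) F x.

Definition hessian (R : realType) (n : nat) (F : 'rV[R]_n -> R) (x : 'rV[R]_n) :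
    'M[R]_n :=
  \matrix_(i, j) partial i (partial j F) x.

(* Class C^k on [U], meaningful for open [U]. *)
Fixpoint smooth (R : realType) (n : nat) (U : set 'rV[R]_n) (k : nat)
    (F : 'rV[R]_n -> R) : Prop :=
  (forall x, U x -> {for x, continuous F}) /\
  match k with
  | 0%N => True
  | k'.+1 => forall i,
      (forall x, U x -> derivable F x (delta_mx ord0 i)) /\
      smooth U k' (partial i F)
  end.

Definition posdef (R : realType) (n : nat) (A : 'M[R]_n) : Prop :=
  forall u : 'rV[R]_n, u != 0 -> 0 < (u *m A *m u^T) ord0 ord0.

(* The pair (theta, v) is the row vector [row_mx theta v]. *)
Definition joint (R : realType) (p d : nat)
    (F : 'rV[R]_p -> 'rV[R]_d -> R) : 'rV[R]_(p + d) -> R :=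
  fun x => F (lsubmx x) (rsubmx x).

Definition joint_set (R : realType) (p d : nat)
    (A : set 'rV[R]_p) (B : set 'rV[R]_d) : set 'rV[R]_(p + d) :=
  [set x | A (lsubmx x) /\ B (rsubmx x)].

Definition is_argmax (R : realType) (X : Type) (D : set X) (F : X -> R) (x : X) :
    Prop :=
  D x /\ forall z, D z -> F z <= F x.

(* R^d with its Borel sigma-algebra. *)
Notation borelV R d := (g_sigma_algebraType (@open 'rV[R]_d)).

(* The values on boxes determine Lebesgue measure among Borel measures. *)
Definition is_lebesgue (R : realType) (d : nat)
    (nu : set (borelV R d) -> \bar R) : Prop :=
  forall a b : 'rV[R]_d, (forall i, a ord0 i <= b ord0 i) ->
    nu [set x : 'rV[R]_d | forall i, a ord0 i < x ord0 i <= b ord0 i] =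
    (\prod_i (b ord0 i - a ord0 i))%:E.

(* Outer probability, so that no measurability of [X n] is needed; on measurable
   events it is [P] ([measurable_mu_extE]). *)
Definition cvg_in_prob (R : realType) (dT : measure_display)
    (T : measurableType dT) (P : probability T R) (W : normedModType R)
    (X : nat -> T -> W) (x : W) : Prop :=
  forall e : R, 0 < e ->
    mu_ext P [set w | e <= `|X n w - x|] @[n --> \oo] --> 0%E.

(* Boundedness in probability inside [D]: the compact sets have to be included in
   [D], so the points can neither escape to infinity nor to the boundary of [D]. *)
Definition tight_in (R : realType) (dT : measure_display)
    (T : measurableType dT) (P : probability T R) (W : normedModType R)
    (D : set W) (X : nat -> T -> W) : Prop :=
  forall e : R, 0 < e -> exists C : set W,
    [/\ compact C, C `<=` D &
        \forall n \near \oo, (mu_ext P [set w | ~ C (X n w)] <= e%:E)%E].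

(* Mutual, not merely pairwise. *)
Definition independent (R : realType) (dT dX : measure_display)
    (T : measurableType dT) (X : measurableType dX) (P : probability T R)
    (V : nat -> T -> X) : Prop :=
  forall (s : seq nat) (A : nat -> set X), uniq s ->
    (forall b, measurable (A b)) ->
    P (\bigcap_(b in [set` s]) (V b @^-1` A b)) =
    (\prod_(b <- s) P (V b @^-1` A b))%E.

Definition iid_from (R : realType) (d : nat) (dT : measure_display)
    (T : measurableType dT) (P : probability T R)
    (nu : {sigma_finite_measure set (borelV R d) -> \bar R})
    (q : 'rV[R]_d -> R) (V : nat -> T -> 'rV[R]_d) : Prop :=
  [/\ forall b, measurable_fun [set: T] (V b : T -> borelV R d),
      forall b (A : set (borelV R d)), measurable A ->
        P (V b @^-1` A) = (\int[nu]_(v in A) (q v)%:E)%E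
    & independent P (V : nat -> T -> borelV R d)].

Section Model.
Context (R : realType) (p d : nat) (dY : measure_display)
  (Y : measurableType dY).
Context (mu : {sigma_finite_measure set Y -> \bar R})
  (nu : {sigma_finite_measure set (borelV R d) -> \bar R}).
(* f theta y v is the joint density of (y, v). *)
Implicit Type f : 'rV[R]_p -> Y -> 'rV[R]_d -> R.

Definition dens_y f (theta : 'rV[R]_p) (y : Y) : R :=
  \int[nu]_v f theta y v.
Definition dens_v f (theta : 'rV[R]_p) (v : 'rV[R]_d) : R :=
  \int[mu]_y f theta y v.
Definition dens_y_v f (theta : 'rV[R]_p) (v : 'rV[R]_d) (y : Y) : R :=
  f theta y v / dens_v f theta v.
Definition dens_v_y f (theta : 'rV[R]_p) (y : Y) (v : 'rV[R]_d) : R :=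
  f theta y v / dens_y f theta y.

(* The support does not depend on theta; it is all of [Oy `*` Ov] because the
   h-likelihood has to be finite at every point of [Ov]. *)
Record is_model (Theta : set 'rV[R]_p) (Oy : set Y) (Ov : set 'rV[R]_d) f :
    Prop := IsModel {
  model_supp : forall theta y v, Theta theta ->
    (0 < f theta y v <-> Oy y /\ Ov v) ;
  model_ge0 : forall theta y v, Theta theta -> 0 <= f theta y v ;
  model_open : open Ov ;
  model_meas : forall theta, Theta theta ->
    measurable_fun [set: Y * borelV R d] (fun z => f theta z.1 z.2) ;
  model_one : forall theta, Theta theta ->
    (\int[(mu \x nu)%E]_z (f theta z.1 z.2)%:E = 1)%E ;
  model_int_v : forall theta y, Theta theta -> Oy y ->
    nu.-integrable [set: borelV R d] (fun v => (f theta y v)%:E) ;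
  model_int_y : forall theta v, Theta theta -> Ov v ->
    mu.-integrable [set: Y] (fun y => (f theta y v)%:E)
}.

Definition int_joint f (theta : 'rV[R]_p) (G : Y -> 'rV[R]_d -> R) : Prop :=
  (mu \x nu)%E.-integrable [set: Y * borelV R d]
    (fun z => (G z.1 z.2 * f theta z.1 z.2)%:E).
Definition E_joint f (theta : 'rV[R]_p) (G : Y -> 'rV[R]_d -> R) : R :=
  \int[(mu \x nu)%E]_z (G z.1 z.2 * f theta z.1 z.2).

(* [vt theta y] is the maximizer of [f theta y]. *)
Definition hlik f (vt : 'rV[R]_p -> Y -> 'rV[R]_d) (y : Y)
    (theta : 'rV[R]_p) (v : 'rV[R]_d) : R :=
  ln (f theta y v) - ln (f theta y (vt theta y)) + ln (dens_y f theta y).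

(* The Monte Carlo sample of size B is V 0, ..., V (B - 1). *)
Definition lik_mc f (q : 'rV[R]_d -> R) (y : Y) (B : nat)
    (V : nat -> 'rV[R]_d) (theta : 'rV[R]_p) : R :=
  B%:R^-1 * \sum_(b < B) (f theta y (V b) / q (V b)).

Definition hlik_mc f (vt : 'rV[R]_p -> Y -> 'rV[R]_d) (q : 'rV[R]_d -> R)
    (y : Y) (B : nat) (V : nat -> 'rV[R]_d)
    (theta : 'rV[R]_p) (v : 'rV[R]_d) : R :=
  ln (f theta y v) - ln (f theta y (vt theta y)) + ln (lik_mc f q y B V theta).

Definition information (h : 'rV[R]_p -> 'rV[R]_d -> R)
    (theta : 'rV[R]_p) (v : 'rV[R]_d) : 'M[R]_(p + d) :=
  - hessian (joint h) (row_mx theta v).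

Definition bartlizable f (Tstar : set 'rV[R]_p)
    (h : Y -> 'rV[R]_p -> 'rV[R]_d -> R) : Prop :=
  forall theta, Tstar theta ->
    let D1 i y v := partial i (joint (h y)) (row_mx theta v) in
    let D2 i j y v := partial i (partial j (joint (h y))) (row_mx theta v) in
    (forall i, int_joint f theta (D1 i) /\ E_joint f theta (D1 i) = 0) /\
    (forall i j,
      [/\ int_joint f theta (fun y v => D1 i y v * D1 j y v),
          int_joint f theta (D2 i j)
        & E_joint f theta
            (fun y v => D1 i y v * D1 j y v + D2 i j y v) = 0]).

Definition fisher_y f (theta : 'rV[R]_p) : 'M[R]_p :=
  \matrix_(i, j) - \int[mu]_y
    (hessian (fun t => ln (dens_y f t y)) theta i j * dens_y f theta y).

Definition fisher_h f (h : Y -> 'rV[R]_p -> 'rV[R]_d -> R)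
    (theta : 'rV[R]_p) : 'M[R]_(p + d) :=
  \matrix_(i, j) E_joint f theta (fun y v => information (h y) theta v i j).

End Model.

(* [g theta] is a density with respect to [m]; derivatives are in theta. *)
Record regular_density (R : realType) (p : nat) (dX : measure_display)
    (X : measurableType dX) (m : {measure set X -> \bar R})
    (U : set 'rV[R]_p) (g : 'rV[R]_p -> X -> R) : Prop := RegularDensity {
  rd_smooth : forall x, smooth U 3 (g ^~ x) ;
  rd_diff1 : forall theta i, U theta ->
    m.-integrable [set: X] (fun x => (partial i (g ^~ x) theta)%:E) /\
    partial i (fun t => \int[m]_x g t x) theta =
    \int[m]_x partial i (g ^~ x) theta ;
  rd_diff2 : forall theta i j, U theta ->
    m.-integrable [set: X]
      (fun x => (partial i (partial j (g ^~ x)) theta)%:E) /\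
    partial i (partial j (fun t => \int[m]_x g t x)) theta =
    \int[m]_x partial i (partial j (g ^~ x)) theta ;
  rd_dom3 : exists M : X -> R,
    m.-integrable [set: X] (fun x => (M x)%:E) /\
    forall theta x i j k, U theta ->
      `|partial i (partial j (partial k (g ^~ x))) theta| <= M x
}.

(* [theta0] is the true value.  Derivatives of the densities are in theta, those
   of [h] in (theta, v).  For [h], the interchange of integration and
   differentiation amounts to the two Bartlett identities. *)
Record regular (R : realType) (p d : nat) (dY : measure_display)
    (Y : measurableType dY) (mu : {sigma_finite_measure set Y -> \bar R})
    (nu : {sigma_finite_measure set (borelV R d) -> \bar R})
    (Theta Tstar : set 'rV[R]_p) (theta0 : 'rV[R]_p)
    (Oy : set Y) (Ov : set 'rV[R]_d) (f : 'rV[R]_p -> Y -> 'rV[R]_d -> R)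
    (h : Y -> 'rV[R]_p -> 'rV[R]_d -> R) : Prop := Regular {
  reg_open : open Tstar ;
  reg_sub : Tstar `<=` Theta ;
  reg_true : Tstar theta0 ;
  reg_model : is_model mu nu Theta Oy Ov f ;
  reg_y : regular_density mu Tstar (dens_y nu f) ;
  reg_v : @regular_density R p _ (borelV R d) nu Tstar (dens_v mu f) ;
  reg_y_v : forall v, Ov v ->
    regular_density mu Tstar (fun theta y => dens_y_v mu f theta v y) ;
  reg_v_y : forall y, Oy y ->
    @regular_density R p _ (borelV R d) nu Tstar
      (fun theta v => dens_v_y nu f theta y v) ;
  reg_h_smooth : forall y, Oy y ->
    smooth (joint_set Tstar Ov) 3 (joint (h y)) ;
  reg_h_bartlett : bartlizable mu nu f Tstar h ;
  reg_h_dom3 : exists M : Y -> 'rV[R]_d -> R,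
    int_joint mu nu f theta0 M /\
    forall theta y v i j k, Tstar theta -> Oy y -> Ov v ->
      `|partial i (partial j (partial k (joint (h y)))) (row_mx theta v)|
        <= M y v ;
  reg_info_y : forall theta, Tstar theta -> posdef (fisher_y mu nu f theta) ;
  reg_info_h : forall theta, Tstar theta -> posdef (fisher_h mu nu f h theta)
}.

Definition is_proposal (R : realType) (d : nat)
    (nu : {sigma_finite_measure set (borelV R d) -> \bar R})
    (Ov : set 'rV[R]_d) (q : 'rV[R]_d -> R) : Prop :=
  [/\ forall v, 0 <= q v,
      measurable_fun [set: borelV R d] (q : borelV R d -> R),
      (\int[nu]_v (q v)%:E = 1)%E
    & forall v, 0 < q v <-> Ov v].

(* Main.v *)
(* Put g(t, v) = f(t, y, v) / L(t), a density in v, and let G_B(t) be the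
   average of g(t, V_b) / q(V_b) over b < B, so that L_B = L G_B and
   h_B = h + ln G_B, where G_B does not depend on v.  By the weak law of large
   numbers G_B -> 1, and its first and second derivatives tend to 0 because they
   have mean zero; the integrable bound on the third derivatives makes these
   limits uniform near every point of Tstar.  Hence h_B -> h locally uniformly,
   which together with tightness and uniqueness of the maximizer gives
   consistency by Wald's argument, and the Hessians of h_B and h differ near the
   limit by the Hessian of ln G_B, which vanishes in probability. *)

Require Import Defs.
From mathcomp Require Import all_boot all_order all_algebra.
From mathcomp Require Import all_classical all_reals all_analysis.
From mathcomp Require Import measurable_realfun ring lra.

Set Implicit Arguments.
Unset Strict Implicit.
Unset Printing Implicit Defensive.

Import Order.TTheory GRing.Theory Num.Theory.
Import numFieldNormedType.Exports.

Local Open Scope classical_set_scope.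
Local Open Scope ring_scope.

(** * Events of outer probability tending to one *)

(** Three obstacles shape the proof. The ratio [f / q] may have infinite variance, as [q] is
    arbitrary, so Chebyshev's inequality is applied to indicators only and the law of large numbers
    reaches integrable functions by approximation in L1. A supremum over uncountably many
    parameters, like the estimators themselves, may fail to be measurable; events are therefore
    measured by outer probability, and uniformity in t comes from a deterministic Lipschitz estimate
    whose constants are averages over the same sample. Thus only finitely many averages, all
    attached to the centre of a box, have to be controlled at random. Finally, the limit
    [row_mx thetah vh] is a maximizer over [Theta], whereas derivatives are controlled on [Tstar].
    Wald's argument asks only for pointwise convergence at the limit and locally uniform convergence
    at its competitors over [Tstar]; once the estimators are known to approach the limit, tightness
    places the limit itself over [Tstar], and the Hessians can be compared there. *)

Section with_high_probability.
Context (R : realType) (dT : measure_display) (T : measurableType dT)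
  (P : probability T R).
Implicit Types A B : nat -> T -> Prop.

(** The complement is what is bounded: outer probability is subadditive, so these events are stable
    under finite conjunction. Asking the outer probability of [A] itself to tend to one would not
    give this, since disjoint nonmeasurable sets can both have outer probability one. *)
Definition whp A : Prop := forall e : R, 0 < e ->
  \forall n \near \oo, (mu_ext P [set w | ~ A n w] <= e%:E)%E.

Lemma whp_near A B : (\forall n \near \oo, forall w, A n w -> B n w) ->
  whp A -> whp B.
Proof.
move=> AB hA e e0; near=> n.
apply: (@le_trans _ _ (mu_ext P [set w | ~ A n w])); last by near: n; exact: hA.
apply: le_mu_ext => w; apply: contra_not; move: w; near: n; exact: AB.
Unshelve. all: by end_near. Qed.

Lemma whp_sub A B : (forall n w, A n w -> B n w) -> whp A -> whp B.
Proof.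
by move=> AB; apply: whp_near; near do exact: AB.
Unshelve. all: by end_near. Qed.

Lemma mu_ext_orP (A B : T -> Prop) :
  (mu_ext P [set w | ~ (A w /\ B w)] <=
   mu_ext P [set w | ~ A w] + mu_ext P [set w | ~ B w])%E.
Proof.
rewrite (_ : [set w | ~ (A w /\ B w)] = [set w | ~ A w] `|` [set w | ~ B w]).
  exact: outer_measureU2.
by apply/seteqP; split => w /=; rewrite not_andP.
Qed.

Lemma whp_and A B : whp A -> whp B -> whp (fun n w => A n w /\ B n w).
Proof.
move=> hA hB e e0; have e20 : 0 < e / 2 by lra.
near=> n; apply: (le_trans (mu_ext_orP _ _)).
rewrite (_ : e = e / 2 + e / 2); last by field.
by rewrite EFinD; apply: leeD; near: n; [exact: hA | exact: hB].
Unshelve. all: by end_near. Qed.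

Lemma whp_true A : (forall n w, A n w) -> whp A.
Proof.
move=> h e e0; near=> n; rewrite (_ : [set w | _] = set0).
  by rewrite outer_measure0 lee_fin ltW.
by apply/seteqP; split => w //=; apply; exact: h.
Unshelve. all: by end_near. Qed.

Lemma whp_seq (I : eqType) (s : seq I) (A : I -> nat -> T -> Prop) :
  (forall i, i \in s -> whp (A i)) ->
  whp (fun n w => forall i, i \in s -> A i n w).
Proof.
elim: s => [|i s IH] h; first exact: whp_true.
have h1 : whp (A i) by apply: h; rewrite mem_head.
have h2 : whp _ :=
  IH (fun j js => h j (mem_behead (js : j \in behead (i :: s)))).
apply: whp_sub (whp_and h1 h2) => n w [Ai As] j.
by rewrite inE => /orP[/eqP->|/As].
Qed.

Lemma whp_forall (I : finType) (A : I -> nat -> T -> Prop) :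
  (forall i, whp (A i)) -> whp (fun n w => forall i, A i n w).
Proof.
move=> h; have /whp_seq := fun i (_ : i \in enum I) => h i.
by apply: whp_sub => n w + i; apply; rewrite mem_enum.
Qed.

Lemma mu_ext_negligible (A : set T) : P.-negligible A -> mu_ext P A = 0%E.
Proof.
move=> [N [mN PN AN]]; apply/eqP; rewrite eq_le mu_ext_ge0 ?andbT//.
by rewrite -PN -measurable_mu_extE//; exact: le_mu_ext.
Qed.

Lemma whp_ae A : (\forall n \near \oo, {ae P, forall w, A n w}) -> whp A.
Proof.
move=> h e e0; near=> n; rewrite mu_ext_negligible ?lee_fin ?ltW//.
by near: n.
Unshelve. all: by end_near. Qed.

Lemma cvg_in_probP (W : normedModType R) (X : nat -> T -> W) (x : W) :
  (forall e, 0 < e -> whp (fun n w => `|X n w - x| < e)) -> cvg_in_prob P X x.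
Proof.
move=> h e e0; apply/fine_cvgP.
have hE n : [set w | ~ `|X n w - x| < e] = [set w | e <= `|X n w - x|].
  by apply/seteqP; split => w /=; rewrite leNgt => /negP.
have fin n : mu_ext P [set w | e <= `|X n w - x|] \is a fin_num.
  rewrite ge0_fin_numE ?mu_ext_ge0//.
  apply: (@le_lt_trans _ _ (mu_ext P setT)); first exact: le_mu_ext.
  rewrite (measurable_mu_extE P measurableT).
  by rewrite [X in (X < _)%E](probability_setT P) ltry.
split; first by near=> n.
apply/cvgrPdist_le => /= d d0; have := h e e0 d d0.
apply: filterS => n; rewrite hE sub0r normrN ger0_norm ?fine_ge0 ?mu_ext_ge0//.
by move=> hn; rewrite -lee_fin fineK.
Unshelve. all: by end_near. Qed.

End with_high_probability.

(** * Weak law of large numbers for integrable functions *)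

Lemma Rintegral_sum (R : realType) d (T : measurableType d)
    (m : {measure set T -> \bar R}) (I : Type) (s : seq I) (F : I -> T -> R) :
  (forall i, m.-integrable setT (EFin \o F i)) ->
  m.-integrable setT (EFin \o (fun x => \sum_(i <- s) F i x)) /\
  \int[m]_x (\sum_(i <- s) F i x) = \sum_(i <- s) \int[m]_x F i x.
Proof.
move=> iF; elim: s => [|i s [IH1 IH2]].
  rewrite big_nil; split.
    by under eq_fun do rewrite big_nil; exact: integrable0.
  under eq_Rintegral do rewrite big_nil.
  by rewrite /Rintegral integral0.
split.
  rewrite (_ : _ \o _ = (EFin \o F i) \+
    (EFin \o (fun x => (\sum_(i <- s) F i x)%R)))%E.
    exact: integrableD.
  by apply/funext => x /=; rewrite big_cons EFinD.
rewrite big_cons -IH2 -RintegralD//.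
by apply: eq_Rintegral => x _; rewrite big_cons.
Qed.

Lemma integrableRD (R : realType) d (T : measurableType d)
    (m : {measure set T -> \bar R}) (f g : T -> R) :
  m.-integrable setT (EFin \o f) -> m.-integrable setT (EFin \o g) ->
  m.-integrable setT (EFin \o (fun x => f x + g x)).
Proof. by move=> mf mg; exact: (integrableD measurableT mf mg). Qed.

Lemma integrableRB (R : realType) d (T : measurableType d)
    (m : {measure set T -> \bar R}) (f g : T -> R) :
  m.-integrable setT (EFin \o f) -> m.-integrable setT (EFin \o g) ->
  m.-integrable setT (EFin \o (fun x => f x - g x)).
Proof. by move=> mf mg; exact: (integrableB measurableT mf mg). Qed.

Lemma integrableRZ (R : realType) d (T : measurableType d)
    (m : {measure set T -> \bar R}) (k : R) (f : T -> R) :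
  m.-integrable setT (EFin \o f) ->
  m.-integrable setT (EFin \o (fun x => k * f x)).
Proof. by move=> mf; exact: (integrableZl measurableT k mf). Qed.

Lemma markov_mu_ext (R : realType) d (T : measurableType d) (P : probability T R)
    (Z : T -> R) (a c : R) :
  measurable_fun setT Z -> 0 < a -> (\int[P]_w `|(Z w)%:E| <= c%:E)%E ->
  (mu_ext P [set w | ~ (`|Z w| < a)%R] <= (c / a)%:E)%E.
Proof.
move=> mZ a0 hc.
have /measurable_EFinP mZE := mZ.
have := le_integral_abse P measurableT mZE a0.
rewrite setTI => /le_trans/(_ hc).
rewrite (_ : [set w | ~ _] = [set x | (a%:E <= `|(EFin \o Z) x|)%E]); last first.
  by apply/seteqP; split => w /=; rewrite lee_fin leNgt => /negP.
rewrite -measurable_mu_extE; last first.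
  rewrite -[X in measurable X]setTI.
  by apply: emeasurable_fun_c_infty => //; exact: measurableT_comp.
by rewrite mulrC EFinM lee_pdivlMl.
Qed.

Section weak_law_of_large_numbers.
Import HBSimple.
Context (R : realType) (dT dX : measure_display) (T : measurableType dT)
  (X : measurableType dX) (P : probability T R) (Q : probability X R)
  (V : nat -> T -> X).
Hypothesis mV : forall b, measurable_fun [set: T] (V b).
Hypothesis lawV : forall b A, measurable A -> P (V b @^-1` A) = Q A.
Hypothesis indV : independent P V.
Implicit Types phi psi : X -> R.

Definition mc_mean phi (B : nat) (w : T) : R :=
  B%:R^-1 * \sum_(b < B) phi (V b w).

Lemma integral_sample b (g : X -> \bar R) :
  measurable_fun setT g -> (forall x, 0 <= g x)%E ->
  (\int[P]_w g (V b w) = \int[Q]_x g x)%E.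
Proof.
move=> mg g0.
have := @ge0_integral_pushforward _ _ _ _ R (V b) (mV b) P setT g measurableT
  mg (fun x _ => g0 x).
rewrite preimage_setT => <-.
by apply: eq_measure_integral => A mA _; exact: lawV.
Qed.

Lemma measurable_mc_mean phi B :
  measurable_fun setT phi -> measurable_fun setT (mc_mean phi B).
Proof.
move=> mphi; apply: measurable_funM => //.
by apply: measurable_sum => b; exact: measurableT_comp.
Qed.

(** Averaging identically distributed terms is a contraction from L1(Q) to L1(P), uniformly in [B];
    this transfers an L1 approximation of the integrand to its sample averages. *)
Lemma le_integral_mc_mean phi B : Q.-integrable setT (EFin \o phi) ->
  (\int[P]_w `|(mc_mean phi B w)%:E| <= \int[Q]_x `|(phi x)%:E|)%E.
Proof.
move=> iphi.
have mphi : measurable_fun setT phi.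
  by apply/measurable_EFinP; exact: measurable_int iphi.
have mphiV b : measurable_fun setT (phi \o V b) by exact: measurableT_comp.
have mE b : measurable_fun setT (fun w => `|(phi (V b w))%:E|%E).
  by apply: measurableT_comp => //; apply/measurable_EFinP; exact: mphiV.
have [->|B0] := eqVneq B 0%N.
  under eq_integral do rewrite /mc_mean big_ord0 mulr0 abse0.
  by rewrite integral0; apply: integral_ge0 => x _; exact: abse_ge0.
apply: (@le_trans _ _
    (\int[P]_w ((B%:R^-1)%:E * \sum_(b < B) `|(phi (V b w))%:E|))%E).
  apply: ge0_le_integral => //.
  - apply: measurableT_comp => //; apply/measurable_EFinP.
    exact: measurable_mc_mean.
  - apply: measurable_funeM.
    exact: emeasurable_sum.
  - move=> w _; rewrite /mc_mean /=.
    rewrite sumEFin -EFinM lee_fin normrM ger0_norm ?invr_ge0//.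
    by rewrite ler_wpM2l ?invr_ge0// ler_norm_sum.
rewrite ge0_integralZl_EFin ?invr_ge0//; last 2 first.
  - by move=> w _; apply: sume_ge0 => i _; exact: abse_ge0.
  - exact: emeasurable_sum.
rewrite ge0_integral_sum//.
under eq_bigr => b _.
  rewrite (integral_sample b (g := fun x => `|(phi x)%:E|%E))//; last first.
    by apply: measurableT_comp => //; exact/measurable_EFinP.
  over.
have /fineK <- := integrable_fin_num measurableT (integrable_abse iphi).
rewrite sumEFin sumr_const card_ord -EFinM lee_fin.
by rewrite -[X in _ * X]mulr_natl mulrA mulVf ?mul1r// pnatr_eq0.
Qed.

Let mean phi : R := \int[Q]_x phi x.

(** For [a != b] the covariance vanishes by independence; for [a = b] it is the variance
    [p - p * p], which is at most 1. *)
Lemma sample_indicator_cov (A : set X) (a b : nat) : measurable A ->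
  let Z c w := \1_A (V c w) - fine (Q A) in
  P.-integrable setT (EFin \o (fun w => Z a w * Z b w)) /\
  \int[P]_w (Z a w * Z b w) <= (a == b)%:R.
Proof.
move=> mA /=; set p := fine (Q A).
have QA : Q A = p%:E by rewrite fineK ?fin_num_measure.
have p0 : 0 <= p by rewrite fine_ge0.
have p1 : p <= 1 by rewrite -lee_fin -QA probability_le1.
have mVA c : measurable (V c @^-1` A).
  by rewrite -[X in measurable X]setTI; exact: mV.
have iV c : P.-integrable setT (EFin \o (\1_(V c @^-1` A) : T -> R)).
  exact: integrable_indic.
have mVab : measurable (V a @^-1` A `&` V b @^-1` A) by exact: measurableI.
have iVab : P.-integrable setT
    (EFin \o (\1_(V a @^-1` A `&` V b @^-1` A) : T -> R)).
  exact: integrable_indic.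
have intV E : measurable E -> \int[P]_w (\1_E w) = fine (P E).
  by move=> mE; rewrite /Rintegral integral_indic// setIT.
have icst : P.-integrable setT (EFin \o (cst (p * p) : T -> R)).
  exact: finite_measure_integrable_cst.
have ZE : (fun w => (\1_A (V a w) - p) * (\1_A (V b w) - p)) =
    (fun w => (\1_(V a @^-1` A `&` V b @^-1` A) w - p * \1_(V a @^-1` A) w) +
              (cst (p * p) w - p * \1_(V b @^-1` A) w)).
  have EV c w : \1_(V c @^-1` A) w = \1_A (V c w) :> R.
    by rewrite !indicE; congr (_%:R); apply/idP/idP => /set_mem ?; apply/mem_set.
  by apply/funext => w; rewrite [in RHS]indicI /= !EV /cst; ring.
have i1 := integrableRB iVab (integrableRZ p (iV a)).
have i2 := integrableRB icst (integrableRZ p (iV b)).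
rewrite ZE; split; first exact: integrableRD.
rewrite RintegralD// RintegralB// ?RintegralB//; try exact: integrableRZ.
rewrite (RintegralZl p measurableT (iV a)) (RintegralZl p measurableT (iV b)).
have PT : fine (P setT) = 1 by rewrite (probability_setT P).
rewrite !intV// !lawV// -/p Rintegral_cst// PT mulr1.
have [<-|ab] := eqVneq a b; first 
  by rewrite setIid lawV// -/p mulr1n; nra.
have uab : uniq [:: a; b] by rewrite /= inE ab.
have := indV uab (fun=> mA).
rewrite bigcap_seq !big_cons !big_nil setIT mule1 !lawV// QA => ->.
by rewrite /=; lra.
Qed.

Definition obeys_lln phi : Prop := Q.-integrable setT (EFin \o phi) /\
  forall e : R, 0 < e ->
    whp P (fun B w => `|mc_mean phi B w - mean phi| < e).

Lemma lln_indic (A : set X) : measurable A -> obeys_lln \1_A.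
Proof.
move=> mA; split; first exact: integrable_indic.
move=> e e0 d d0.
have -> : mean \1_A = fine (Q A).
  by rewrite /mean /Rintegral integral_indic// setIT.
set p := fine (Q A).
pose Z c w := \1_A (V c w) - p.
have hZ a b := sample_indicator_cov a b mA.
near=> B.
have B0 : (0 : R) < B%:R by rewrite ltr0n; near: B; exists 1%N.
pose S w := mc_mean \1_A B w - p.
(* Chebyshev: the products off the diagonal have nonpositive expectation and the [B] diagonal ones
   at most 1, so the expected square is at most [B^-1]. *)
have SE w : S w ^+ 2 = B%:R^-1 ^+ 2 * \sum_(a < B) \sum_(b < B) (Z a w * Z b w).
  under eq_bigr do rewrite -mulr_sumr.
  rewrite -mulr_suml /S /mc_mean /Z sumrB sumr_const card_ord -expr2 -exprMn.
  by congr (_ ^+ 2); rewrite mulrBr -(mulr_natl p) mulKf// gt_eqF.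
have i1 a := Rintegral_sum (index_enum 'I_B) (fun b => (hZ a b).1).
have i2 := Rintegral_sum (index_enum 'I_B) (fun a : 'I_B => (i1 a).1).
have mS : measurable_fun setT S.
  apply: measurable_funB => //; apply: measurable_mc_mean.
  exact/measurable_indicP.
have hint : (\int[P]_w `|(S w ^+ 2)%:E| <= (B%:R^-1)%:E)%E.
  under eq_integral do rewrite abse_EFin ger0_norm ?sqr_ge0// SE.
  have i3 := integrable_fin_num measurableT (integrableRZ (B%:R^-1 ^+ 2) i2.1).
  rewrite -[leLHS]fineK ?i3// lee_fin.
  rewrite -[leLHS]/(\int[P]_w (B%:R^-1 ^+ 2 *
    \sum_(a < B) \sum_(b < B) (Z a w * Z b w))).
  rewrite RintegralZl//; last exact: i2.1.
  rewrite i2.2 expr2 -mulrA ler_piMr ?invr_ge0// mulrC ler_pdivrMr// mul1r.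
  rewrite (_ : B%:R = \sum_(a < B) (1 : R)); last first.
    by rewrite sumr_const card_ord.
  apply: ler_sum => a _; rewrite (i1 a).2.
  apply: (@le_trans _ _ (\sum_(b < B) ((a : nat) == b)%:R)).
    by apply: ler_sum => b _; exact: (hZ a b).2.
  rewrite (bigD1 a)//= eqxx big1 ?addr0// => b ba.
  by rewrite (_ : (a : nat) == b = false)//; apply/negbTE; rewrite eq_sym.
have := markov_mu_ext (measurable_funX 2 mS) (exprn_gt0 2 e0) hint.
rewrite (_ : [set w | _] = [set w | ~ `|S w| < e]); last first.
  apply/seteqP; split => w; by rewrite /= normrX ltr_pXn2r ?nnegrE ?(ltW e0).
move=> /le_trans; apply; rewrite lee_fin ler_pdivrMr ?exprn_gt0//.
rewrite -[leLHS]mul1r ler_pdivrMr// -ler_pdivrMl ?mulr_gt0 ?exprn_gt0// mulr1.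
by near: B; exact: nbhs_infty_ger.
Unshelve. all: by end_near. Qed.

Lemma llnD phi psi : obeys_lln phi -> obeys_lln psi ->
  obeys_lln (fun x => phi x + psi x).
Proof.
move=> [iphi hphi] [ipsi hpsi]; split; first exact: integrableRD.
move=> e e0; have e20 : 0 < e / 2 by lra.
apply: whp_sub (whp_and (hphi _ e20) (hpsi _ e20)) => B w [].
rewrite /mean RintegralD// /mc_mean big_split/= mulrDr => h1 h2.
rewrite opprD addrACA (le_lt_trans (ler_normD _ _))// (_ : e = e / 2 + e / 2).
  exact: ltrD.
by field.
Qed.

Lemma llnZ k phi : obeys_lln phi -> obeys_lln (fun x => k * phi x).
Proof.
move=> [iphi hphi]; split; first exact: integrableRZ.
move=> e e0; have e20 : 0 < e / (`|k| + 1) by rewrite divr_gt0// ltr_wpDl.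
apply: whp_sub (hphi _ e20) => B w.
rewrite /mean RintegralZl// /mc_mean -mulr_sumr mulrCA -mulrBr normrM => h.
rewrite ltr_pdivlMr ?ltr_wpDl// in h.
by apply: le_lt_trans h; rewrite mulrC ler_wpM2l// lerDl.
Qed.

Lemma lln_sum n (phi : 'I_n -> X -> R) : (forall i, obeys_lln (phi i)) ->
  obeys_lln (fun x => \sum_(i < n) phi i x).
Proof.
elim: n phi => [|n IH] phi h.
  have := llnZ 0 (lln_indic measurableT).
  by congr obeys_lln; apply/funext => x; rewrite big_ord0 mul0r.
have := llnD (h ord0) (IH _ (fun i => h (lift ord0 i))).
by congr obeys_lln; apply/funext => x; rewrite big_ord_recl.
Qed.

Lemma lln_sfun (phi : {sfun X >-> R}) : obeys_lln phi.
Proof.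
have -> : (phi : X -> R) = _ := funext (fimfunEord phi).
apply: lln_sum => i; apply: llnZ; apply: lln_indic.
exact: measurable_funPTI.
Qed.

Lemma weak_lln phi : Q.-integrable setT (EFin \o phi) ->
  forall e : R, 0 < e ->
    whp P (fun B w => `|mc_mean phi B w - \int[Q]_x phi x| < e).
Proof.
move=> iphi e e0 d d0.
have [g [ig _ /fine_cvgP[_ hg]]] :=
  approximation_sfun_integrable measurableT iphi.
(* The first entry bounds the bias [mean phi - mean (g N)]; the second makes Markov's inequality at
   level [e / 3] leave probability at most [d / 2]. *)
pose c := Num.min (e / 3) (d / 2 * (e / 3)).
have c0 : 0 < c by rewrite lt_min !mulr_gt0 ?divr_gt0.
have /cvgrPdist_lt /(_ _ c0)[N _ /(_ N (leqnn N)) hN] := hg.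
pose D x := phi x - g N x.
have iD : Q.-integrable setT (EFin \o D) by exact: integrableRB.
have hD : (\int[Q]_x `|(D x)%:E| <= c%:E)%E.
  move: hN; rewrite /= sub0r normrN ger0_norm ?fine_ge0 ?integral_ge0// => hN.
  rewrite -[leLHS]fineK ?lee_fin ?ltW//.
  exact: (integrable_fin_num measurableT (integrable_abse iD)).
have e30 : 0 < e / 3 by rewrite divr_gt0.
have d20 : 0 < d / 2 by rewrite divr_gt0.
have hg' := (lln_sfun (g N)).2 _ e30 _ d20.
near=> B.
have mD : measurable_fun setT D.
  by apply/measurable_EFinP; exact: measurable_int iD.
have hM : (mu_ext P [set w | ~ (`|mc_mean D B w| < e / 3)%R] <= (d / 2)%:E)%E.
  have := markov_mu_ext (measurable_mc_mean B mD) e30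
    (le_trans (le_integral_mc_mean B iD) hD).
  move=> /le_trans; apply; rewrite lee_fin ler_pdivrMr//.
  by rewrite /c ge_min lexx orbT.
rewrite (_ : d = d / 2 + d / 2); last by field.
have hgB : (mu_ext P [set w | ~ (`|mc_mean (g N) B w - mean (g N)| < e / 3)%R]
    <= (d / 2)%:E)%E.
  by near: B; exact: hg'.
rewrite EFinD; apply: le_trans (leeD hgB hM).
apply: le_trans (mu_ext_orP _ _ _); apply: le_mu_ext => w.
apply: contra_not => -[h1 h2].
have hDn : `|mean phi - mean (g N)| <= c.
  rewrite /mean -RintegralB//.
  rewrite -lee_fin EFin_normr_Rintegral//; apply: le_trans hD.
  by apply: le_abse_integral => //; exact: measurable_int iD.
have c3 : c <= e / 3 by rewrite /c ge_min lexx.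
have -> : mc_mean phi B w - \int[Q]_x phi x =
   (mc_mean (g N) B w - mean (g N)) + (mc_mean D B w - (mean phi - mean (g N))).
  have -> : mc_mean D B w = mc_mean phi B w - mc_mean (g N) B w.
    by rewrite /mc_mean -mulrBr sumrB.
  rewrite /mean; ring.
apply: (le_lt_trans (ler_normD _ _)).
have := ler_normB (mc_mean D B w) (mean phi - mean (g N)).
move: h1 h2 hDn c3; lra.
Unshelve. all: by end_near. Qed.

End weak_law_of_large_numbers.

(** * Importance sampling *)

Section density_law.
Context (R : realType) (dX : measure_display) (X : measurableType dX)
  (m : {sigma_finite_measure set X -> \bar R}) (Q : probability X R)
  (q : X -> R).
Hypothesis mq : measurable_fun [set: X] q.
Hypothesis q0 : forall x, 0 <= q x.
Hypothesis Qq : forall A, measurable A -> Q A = (\int[m]_(x in A) (q x)%:E)%E.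

Let mqE : measurable_fun [set: X] (EFin \o q).
Proof. exact/measurable_EFinP. Qed.

Let Qm : Q `<< m.
Proof.
apply/null_content_dominatesP => A mA mA0.
by rewrite Qq// null_set_integral//; exact: measurable_funTS.
Qed.

Let rn_ae : ae_eq m setT (Radon_Nikodym_SigmaFinite.f Q m) (EFin \o q).
Proof.
apply: integral_ae_eq => //; first exact: Radon_Nikodym_SigmaFinite.f_integrable.
by move=> E _ mE; rewrite -Radon_Nikodym_SigmaFinite.f_integral//; exact: Qq.
Qed.

Let mrn : measurable_fun setT (Radon_Nikodym_SigmaFinite.f Q m).
Proof. exact: measurable_int (Radon_Nikodym_SigmaFinite.f_integrable Qm). Qed.

Lemma ge0_integral_density_law (phi : X -> \bar R) :
  measurable_fun setT phi -> (forall x, 0 <= phi x)%E ->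
  (\int[Q]_x phi x = \int[m]_x (phi x * (q x)%:E))%E.
Proof.
move=> mphi phi0.
rewrite -(Radon_Nikodym_SigmaFinite.change_of_variables Qm phi0 measurableT mphi).
apply: ae_eq_integral => //; try exact: emeasurable_funM.
exact: ae_eqe_mul2l.
Qed.

(** Where [q] vanishes so does [g], hence [g x / q x * q x = g x] everywhere with the convention
    [x / 0 = 0], and the factor [q] is the density of [Q]. *)
Lemma density_law_quotient (g : X -> R) :
  m.-integrable setT (EFin \o g) -> (forall x, q x = 0 -> g x = 0) ->
  Q.-integrable setT (EFin \o (fun x => g x / q x)) /\
  \int[Q]_x (g x / q x) = \int[m]_x g x.
Proof.
move=> ig g0.
have mg : measurable_fun setT g.
  by apply/measurable_EFinP; exact: measurable_int ig.
have mphi : measurable_fun setT (fun x => g x / q x).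
  (* Measurability of the quotient: [expR (- ln (q x))] is [(q x)^-1] where [q x > 0], and elsewhere
     both products are 0 because [g x = 0]. *)
  rewrite (_ : (fun _ => _) = (fun x => g x * expR (- ln (q x)))).
    apply: measurable_funM => //; apply: measurableT_comp => //.
    by apply: measurable_funN; apply: measurableT_comp => //; exact: measurable_ln.
  apply/funext => x; have [/[dup]/g0-> ->|qx] := eqVneq (q x) 0.
    by rewrite !mul0r.
  by rewrite expRN lnK// posrE lt_def qx q0.
have gqK x : g x / q x * q x = g x.
  by have [/[dup]/g0-> ->|qx] := eqVneq (q x) 0; rewrite ?mulr0// divfK.
have iphi : Q.-integrable setT (EFin \o (fun x => g x / q x)).
  apply/integrableP; split; first exact/measurable_EFinP.
  rewrite ge0_integral_density_law//; last first.
    by apply: measurableT_comp => //; exact/measurable_EFinP.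
  have /integrableP[_] := ig; congr (_ < _)%E; apply: eq_integral => x _ /=.
  by rewrite -[in LHS](gqK x) normrM (ger0_norm (q0 x)) EFinM.
split=> //; congr fine.
have gE : (fun x => (g x)%:E) =
    ((EFin \o (fun x => (g x / q x)%R)) \* (EFin \o q))%E.
  by apply/funext => x /=; rewrite -EFinM gqK.
rewrite -(Radon_Nikodym_change_of_variables Qm measurableT iphi).
apply: ae_eq_integral => //.
- apply: emeasurable_funM; first exact/measurable_EFinP.
  by apply: measurable_int; exact: Radon_Nikodym_integrable.
- exact/measurable_EFinP.
- rewrite gE; apply: ae_eqe_mul2l.
  apply: ae_eq_trans rn_ae; apply: ae_eq_sym.
  exact: ae_eq_Radon_Nikodym_SigmaFinite Qm _ measurableT.
Qed.

End density_law.

Lemma importance_sampling_lln (R : realType) (dT dX : measure_display)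
    (T : measurableType dT) (X : measurableType dX) (P : probability T R)
    (m : {sigma_finite_measure set X -> \bar R}) (q : X -> R)
    (V : nat -> T -> X) (g : X -> R) (e : R) :
  measurable_fun [set: X] q -> (forall x, 0 <= q x) ->
  (forall b, measurable_fun [set: T] (V b)) ->
  (forall b A, measurable A ->
    P (V b @^-1` A) = (\int[m]_(x in A) (q x)%:E)%E) ->
  independent P V ->
  m.-integrable setT (EFin \o g) -> (forall x, q x = 0 -> g x = 0) -> 0 < e ->
  whp P (fun B w =>
    `|B%:R^-1 * \sum_(b < B) (g (V b w) / q (V b w)) - \int[m]_x g x| < e).
Proof.
move=> mq q0 mV law ind ig g0 e0.
pose V0 : {mfun T >-> X} := mfun_Sub (mem_set (mV 0%N)).
pose Q : probability X R := distribution P V0.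
have lawQ b A : measurable A -> P (V b @^-1` A) = Q A.
  by move=> mA; rewrite law// -(law 0%N).
have Qq A : measurable A -> Q A = (\int[m]_(x in A) (q x)%:E)%E.
  by move=> mA; rewrite -(law 0%N).
have [iphi <-] := density_law_quotient mq q0 Qq ig g0.
exact: (weak_lln mV lawQ ind iphi).
Qed.

(** Meant for dominating functions, which need not vanish where [q] does. Terms with [q (V b w) = 0]
    are 0 by the convention [x / 0 = 0], so the average is that of [g] cut off to [D]. *)
Lemma importance_sampling_lln_restrict (R : realType) (dT dX : measure_display)
    (T : measurableType dT) (X : measurableType dX) (P : probability T R)
    (m : {sigma_finite_measure set X -> \bar R}) (q : X -> R)
    (V : nat -> T -> X) (g : X -> R) (e : R) :
  measurable_fun [set: X] q -> (forall x, 0 <= q x) ->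
  (forall b, measurable_fun [set: T] (V b)) ->
  (forall b A, measurable A ->
    P (V b @^-1` A) = (\int[m]_(x in A) (q x)%:E)%E) ->
  independent P V -> m.-integrable setT (EFin \o g) -> 0 < e ->
  whp P (fun B w => `|B%:R^-1 * \sum_(b < B) (g (V b w) / q (V b w)) -
                      \int[m]_(x in [set x | q x != 0]) g x| < e).
Proof.
move=> mq q0 mV law ind ig e0; set D := [set x | q x != 0].
have mD : measurable D.
  rewrite (_ : D = setT `&` q @^-1` (~` [set 0])).
    by apply: mq => //; exact: measurableC.
  by apply/seteqP; split => x /=; [move=> /eqP | move=> [_ /eqP]].
have igD : m.-integrable setT (EFin \o (g \_ D)).
  rewrite -restrict_EFin; apply/(integrable_mkcond _ mD).
  exact: integrableS ig.
have gD0 x : q x = 0 -> (g \_ D) x = 0.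
  by move=> qx; rewrite patchE memNset// /D /= qx eqxx.
have := importance_sampling_lln mq q0 mV law ind igD gD0 e0.
apply: whp_sub => B w; rewrite -Rintegral_mkcond.
congr (`|_ * _ - _| < _); apply: eq_bigr => b _; rewrite patchE.
have [qb|qb] := eqVneq (q (V b w)) 0; first by rewrite qb invr0 !mulr0.
by rewrite mem_set.
Qed.

(** * Partial derivatives *)

Section directional_derivative.
Context (R : realType) (V : normedModType R).
Implicit Types (F G : V -> R) (x v : V).

Let line_quotient F v x (s : R) :
  (fun h : R => h^-1 *: (F ((h%:A + s) *: v + x) - F (s *: v + x))) =
  (fun h : R => h^-1 *: (F (h *: v + (s *: v + x)) - F (s *: v + x))).
Proof. by apply/funext => h; rewrite [h%:A]mulr1 scalerDl addrA. Qed.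

Lemma derivable_line F v x (s : R) :
  derivable (fun t : R => F (t *: v + x)) s 1 <-> derivable F (s *: v + x) v.
Proof. by rewrite /derivable /= line_quotient. Qed.

Lemma derive_line F v x (s : R) :
  'D_1 (fun t : R => F (t *: v + x)) s = 'D_v F (s *: v + x).
Proof. by rewrite /derive /= line_quotient. Qed.

Lemma is_derive_line F v x (s d : R) :
  is_derive (s *: v + x) v F d -> is_derive s 1 (fun t : R => F (t *: v + x)) d.
Proof.
move=> [dF <-]; apply: DeriveDef; [exact/derivable_line | exact: derive_line].
Qed.

(** Only one direction is differentiable, so the one-variable chain rule is applied along the line
    [t *: v + x]. *)
Lemma is_derive_ln_comp F v x (d : R) : 0 < F x -> is_derive x v F d ->
  is_derive x v (fun y => ln (F y)) (d / F x).
Proof.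
move=> Fx dF.
have x0 : 0 *: v + x = x by rewrite scale0r add0r.
have d0 : is_derive (0 : R) 1 (fun t : R => F (t *: v + x)) d.
  by apply: is_derive_line; rewrite x0.
have l0 : is_derive (F (0 *: v + x)) 1 (@ln R) (F x)^-1.
  by rewrite x0; exact: is_derive1_ln.
have [c1 c2] := is_derive1_comp l0 d0.
have := (derivable_line (fun y => ln (F y)) v x 0).1 c1.
have := derive_line (fun y => ln (F y)) v x 0.
rewrite c2 x0 => De dlF.
by apply: DeriveDef => //; rewrite -De mulrC.
Qed.

Lemma mean_value_line F v x (a b K : R) : a <= b ->
  (forall s, a <= s <= b -> derivable F (s *: v + x) v) ->
  (forall s, a <= s <= b -> `|'D_v F (s *: v + x)| <= K) ->
  `|F (b *: v + x) - F (a *: v + x)| <= K * (b - a).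
Proof.
move=> ab dF bF; pose g (t : R) := F (t *: v + x).
have dg s : a <= s <= b -> is_derive s 1 g ('D_v F (s *: v + x)).
  by move=> hs; apply: is_derive_line; apply: DeriveDef => //; exact: dF.
have cg : {within `[a, b], continuous g}.
  by apply: derivable_within_continuous => s; rewrite in_itv => /dg[].
have og s : s \in `]a, b[ -> is_derive s 1 g ('D_v F (s *: v + x)).
  by rewrite in_itv => /andP[/ltW ? /ltW ?]; apply: dg; apply/andP.
have [c cab ->] := MVT_segment ab og cg.
by rewrite normrM ler_pM// ?bF// ger0_norm// subr_ge0.
Qed.

End directional_derivative.

Lemma row_nbhs_box (R : realType) n (c : 'rV[R]_n) (A : set 'rV[R]_n) :
  nbhs c A -> exists2 r, 0 < r &
    forall x : 'rV[R]_n, (forall i, `|x ord0 i - c ord0 i| < r) -> A x.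
Proof.
move=> /nbhs_ballP[r /= r0 rA]; exists r => // x hx; apply: rA.
by split=> // i j; rewrite ord1 /ball /= distrC.
Qed.

Lemma row_box_nbhs (R : realType) n (c : 'rV[R]_n) (r : R) : 0 < r ->
  nbhs c [set x : 'rV[R]_n | forall i, `|x ord0 i - c ord0 i| < r].
Proof.
move=> r0; apply/nbhs_ballP; exists r => // x [_ hx] i.
by have := hx ord0 i; rewrite /ball /= distrC.
Qed.

(* Walk from [c] to [x] changing one coordinate at a time: only partial
   derivatives are needed, and the box is not left. *)
Lemma partial_mean_value (R : realType) n (F : 'rV[R]_n -> R) (c : 'rV[R]_n)
    (r K : R) :
  let box (x : 'rV[R]_n) := forall i, `|x ord0 i - c ord0 i| < r in
  (forall i x, box x -> derivable F x (delta_mx ord0 i)) ->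
  (forall i x, box x -> `|partial i F x| <= K) ->
  forall x, box x -> `|F x - F c| <= n%:R * (K * r).
Proof.
move=> box dF bF x bx.
pose y k : 'rV[R]_n := \row_j (if (j < k)%N then x ord0 j else c ord0 j).
have step (i : 'I_n) : `|F (y i.+1) - F (y i)| <= K * r.
  have r0 : 0 < r by apply: le_lt_trans (bx i).
  have K0 : 0 <= K by apply: le_trans (bF i x bx).
  pose e : 'rV[R]_n := delta_mx ord0 i.
  (* The [i]-th coordinate of [z] is 0, so [s *: e + z] runs through the segment from [y i], at
     [s = c ord0 i], to [y i.+1], at [s = x ord0 i]. *)
  pose z := y i - c ord0 i *: e.
  have zE s : s *: e + z = \row_j
      (if (j < i)%N then x ord0 j else if j == i then s else c ord0 j).
    apply/rowP => j; rewrite !mxE eqxx /=.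
    have [->|ji] := eqVneq j i; first by rewrite ltnn mulr1 mulr1; ring.
    by rewrite !mulr0 subr0 add0r.
  have y0 : y i = c ord0 i *: e + z.
    by rewrite addrC subrK.
  have y1 : y i.+1 = x ord0 i *: e + z.
    rewrite zE; apply/rowP => j; rewrite !mxE ltnS leq_eqVlt -val_eqE /=.
    by have [ji|ji] := eqVneq (val j) (val i); rewrite //= ji ltnn (val_inj ji).
  pose g s := s *: e + z.
  have bg s : (c ord0 i <= s <= x ord0 i) || (x ord0 i <= s <= c ord0 i) ->
      box (s *: e + z).
    move=> hs j; rewrite zE mxE; case: ifP => _; first exact: bx.
    have [->|ji] := eqVneq j i; last by rewrite subrr normr0.
    have := bx i; rewrite !ltr_norml => /andP[h1 h2].
    by case/orP: hs => /andP[h3 h4]; apply/andP; split; lra.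
  have bxi : `|x ord0 i - c ord0 i| <= r by rewrite ltW.
  rewrite y0 y1; have [cx|xc] := leP (c ord0 i) (x ord0 i).
    apply: (@le_trans _ _ (K * (x ord0 i - c ord0 i))).
      apply: mean_value_line => // s hs.
        by apply: dF; apply: bg; rewrite hs.
      by apply: bF; apply: bg; rewrite hs.
    by rewrite ler_wpM2l// (le_trans (ler_norm _)).
  rewrite distrC; apply: (@le_trans _ _ (K * (c ord0 i - x ord0 i))).
    apply: mean_value_line => [|s hs|s hs]; first exact: ltW.
      by apply: dF; apply: bg; rewrite hs orbT.
    by apply: bF; apply: bg; rewrite hs orbT.
  by rewrite ler_wpM2l// (le_trans (ler_norm _))// distrC.
have yn : y n = x by apply/rowP => j; rewrite mxE ltn_ord.
have y0 : y 0%N = c by apply/rowP => j; rewrite mxE.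
have -> : F x - F c = \sum_(i < n) (F (y i.+1) - F (y i)).
  rewrite -[in LHS]yn -[in LHS]y0.
  by rewrite -(telescope_sumr (F \o y) (leq0n n)) big_mkord.
apply: (le_trans (ler_norm_sum _ _ _)).
apply: (@le_trans _ _ (\sum_(i < n) (K * r))); first exact: ler_sum.
by rewrite sumr_const card_ord mulr_natl.
Qed.

Lemma ler_norm_near (R : realDomainType) (a b S K L : R) :
  `|a - b| <= L -> L <= K -> `|b| <= S -> `|a| <= S + K.
Proof.
move=> ab LK bS; rewrite -(subrK b a) addrC (le_trans (ler_normD _ _))// lerD//.
exact: le_trans LK.
Qed.

Lemma ler_sum_term (R : numDomainType) (I : finType) (F : I -> R) (i : I) :
  (forall j, 0 <= F j) -> F i <= \sum_j F j.
Proof. by move=> F0; rewrite (bigD1 i)//= lerDl sumr_ge0. Qed.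

Section smooth_functions.
Context (R : realType) (n : nat).
Implicit Types (U : set 'rV[R]_n) (F : 'rV[R]_n -> R).

Lemma smooth_continuous U k F x : smooth U k F -> U x -> {for x, continuous F}.
Proof. by case: k => [|k] /= [h _]; exact: h. Qed.

Lemma smooth_derivable U k F i x : smooth U k.+1 F -> U x ->
  derivable F x (delta_mx ord0 i).
Proof. by move=> /= [_ /(_ i)[h _]]; exact: h. Qed.

Lemma smooth_partial U k F i : smooth U k.+1 F -> smooth U k (partial i F).
Proof. by move=> /= [_ /(_ i)[]]. Qed.

Lemma smooth_sub U (U' : set 'rV[R]_n) k F :
  U' `<=` U -> smooth U k F -> smooth U' k F.
Proof.
move=> UU; elim: k F => [|k IH] F /= [cF dF].
  by split=> // x /UU; exact: cF.
split=> [x /UU|i]; first exact: cF.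
by have [dFi sFi] := dF i; split=> [x /UU|]; [exact: dFi | exact: IH].
Qed.

Lemma near_eq_partial F G i x : (\near x, F x = G x) ->
  partial i F x = partial i G x.
Proof. exact: near_eq_derive. Qed.

Lemma open_eq_partial U F G i : open U -> (forall x, U x -> F x = G x) ->
  forall x, U x -> partial i F x = partial i G x.
Proof.
move=> oU FG x Ux; apply: near_eq_partial.
by near do apply: FG; exact: open_nbhs_nbhs.
Unshelve. all: by end_near. Qed.

Lemma partial_cst (k : R) i x : partial i (cst k : 'rV[R]_n -> R) x = 0.
Proof. exact: derive_cst. Qed.

(** A bound for the second partial derivatives on a box of half-width at most 1 around [c], when [M]
    bounds the third ones: values at [c] plus a mean value increment. [F] enters only through its
    derivatives at [c], which keeps the bound integrable when [F] depends on a sample point. *)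
Definition second_order_const F (c : 'rV[R]_n) (M : R) : R :=
  \sum_i \sum_j `|partial i (partial j F) c| + n%:R * M.

Definition first_order_const F (c : 'rV[R]_n) (M : R) : R :=
  \sum_i `|partial i F c| + n%:R * second_order_const F c M.

(** The bound descends one order at a time: a bound at order k + 1 gives a Lipschitz estimate at
    order k, which together with [rho <= 1] and the values at [c] bounds order k on the box. The
    radius [r] stays free, to be made small afterwards. *)
Lemma smooth3_local_lipschitz U F (c : 'rV[R]_n) (M rho : R) :
  smooth U 3 F -> 0 <= M ->
  (forall i j k x, U x -> `|partial i (partial j (partial k F)) x| <= M) ->
  rho <= 1 ->
  (forall x : 'rV[R]_n, (forall i, `|x ord0 i - c ord0 i| < rho) -> U x) ->
  forall (r : R) (x : 'rV[R]_n), 0 < r <= rho ->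
  (forall i, `|x ord0 i - c ord0 i| < r) ->
  [/\ `|F x - F c| <= n%:R * (first_order_const F c M * r),
      forall i, `|partial i F x - partial i F c| <=
                n%:R * (second_order_const F c M * r) &
      forall i j, `|partial i (partial j F) x - partial i (partial j F) c| <=
                n%:R * (M * r)].
Proof.
move=> sF M0 bF rho1 hU.
have dU r : r <= rho -> forall x : 'rV[R]_n,
    (forall i, `|x ord0 i - c ord0 i| < r) -> U x.
  by move=> rr x hx; apply: hU => i; exact: lt_le_trans (hx i) rr.
have h2 r (x : 'rV[R]_n) : r <= rho -> (forall i, `|x ord0 i - c ord0 i| < r) ->
    forall i j, `|partial i (partial j F) x - partial i (partial j F) c| <=
                n%:R * (M * r).
  move=> rr hx i j; apply: partial_mean_value hx => k y /(dU _ rr) Uy.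
    exact: (smooth_derivable (smooth_partial i (smooth_partial j sF)) Uy).
  exact: bF.
have b2 (x : 'rV[R]_n) : (forall i, `|x ord0 i - c ord0 i| < rho) ->
    forall i j, `|partial i (partial j F) x| <= second_order_const F c M.
  move=> hx i j; have h2' := h2 _ x (lexx rho) hx i j.
  have hM : n%:R * (M * rho) <= n%:R * M by rewrite ler_wpM2l// ler_piMr.
  apply: ler_norm_near h2' hM _.
  apply: (le_trans _ (ler_sum_term
    (F := fun i => \sum_j `|partial i (partial j F) c|) i _)) => [|l].
    by apply: (ler_sum_term (F := fun j => `|partial i (partial j F) c|)).
  by rewrite sumr_ge0.
have A20 : 0 <= second_order_const F c M.
  by rewrite addr_ge0 ?mulr_ge0// sumr_ge0// => i _; rewrite sumr_ge0.
have h1 r (x : 'rV[R]_n) : r <= rho -> (forall i, `|x ord0 i - c ord0 i| < r) ->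
    forall j, `|partial j F x - partial j F c| <=
              n%:R * (second_order_const F c M * r).
  move=> rr hx j; apply: partial_mean_value hx => k y hy.
    exact: (smooth_derivable (smooth_partial j sF) (dU _ rr _ hy)).
  by apply: b2 => i; exact: lt_le_trans (hy i) rr.
have b1 (x : 'rV[R]_n) : (forall i, `|x ord0 i - c ord0 i| < rho) ->
    forall j, `|partial j F x| <= first_order_const F c M.
  move=> hx j; have h1' := h1 _ x (lexx rho) hx j.
  have hM : n%:R * (second_order_const F c M * rho) <=
            n%:R * second_order_const F c M.
    by rewrite ler_wpM2l// ler_piMr.
  apply: ler_norm_near h1' hM _.
  exact: (ler_sum_term (F := fun j => `|partial j F c|)).
move=> r x /andP[r0 rr] hx; split; [|exact: h1|exact: h2].
apply: partial_mean_value hx => k y hy.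
  exact: (smooth_derivable sF (dU _ rr _ hy)).
by apply: b1 => i; exact: lt_le_trans (hy i) rr.
Qed.

End smooth_functions.

Lemma is_derive_weighted_sum (R : realType) (V : normedModType R) (B : nat)
    (F : 'I_B -> V -> R) (a : 'I_B -> R) (k : R) (x v : V) :
  (forall b, derivable (F b) x v) ->
  is_derive x v (fun y => k * \sum_b (F b y * a b))
                (k * \sum_b ('D_v (F b) x * a b)).
Proof.
move=> dF.
have h b : is_derive x v (a b *: F b) (a b *: 'D_v (F b) x).
  by apply: is_deriveZ; apply: DeriveDef.
have := is_deriveZ k (is_derive_sum h).
congr is_derive.
  apply/funext => y; rewrite -[LHS]/(k * _ y) fct_sumE; congr (_ * _).
  by apply: eq_bigr => b _; rewrite mulrC.
by congr (_ * _); apply: eq_bigr => b _; rewrite mulrC.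
Qed.

Lemma weighted_mean_close (R : realType) (B : nat) (s t A a : 'I_B -> R)
    (c k : R) :
  0 <= c -> (forall b, 0 <= a b) -> (forall b, `|s b - t b| <= k * A b) ->
  `|c * \sum_b (s b * a b) - c * \sum_b (t b * a b)| <=
  k * (c * \sum_b (A b * a b)).
Proof.
move=> c0 a0 hst; rewrite -mulrBr -sumrB normrM ger0_norm// mulrCA ler_wpM2l//.
apply: (le_trans (ler_norm_sum _ _ _)); rewrite mulr_sumr; apply: ler_sum => b _.
by rewrite -mulrBl normrM (ger0_norm (a0 b)) mulrA ler_wpM2r.
Qed.

(** * Locally uniform law of large numbers *)

Definition weighted_mean (R : realType) (X : Type) (q : X -> R) (B : nat)
    (s : nat -> X) (h : X -> R) : R :=
  B%:R^-1 * \sum_(b < B) (h (s b) / q (s b)).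

Section local_uniform_lln.
Context (R : realType) (n : nat) (dT dX : measure_display)
  (T : measurableType dT) (X : measurableType dX) (P : probability T R)
  (m : {sigma_finite_measure set X -> \bar R}) (q : X -> R)
  (V : nat -> T -> X).
Hypothesis mq : measurable_fun [set: X] q.
Hypothesis q0 : forall x, 0 <= q x.
Hypothesis mV : forall b, measurable_fun [set: T] (V b).
Hypothesis lawV : forall b A, measurable A ->
  P (V b @^-1` A) = (\int[m]_(x in A) (q x)%:E)%E.
Hypothesis indV : independent P V.

(** These averages tend to an integral over the set where [q] is nonzero; an upper bound is all that
    the Lipschitz estimate asks for. *)
Lemma weighted_mean_whp_bounded (h : X -> R) : m.-integrable setT (EFin \o h) ->
  exists2 C, 0 <= C & whp P (fun B w => weighted_mean q B (V ^~ w) h <= C).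
Proof.
move=> ih; set c := \int[m]_(x in [set x | q x != 0]) h x.
exists (`|c| + 1); first by rewrite addr_ge0.
have := importance_sampling_lln_restrict mq q0 mV lawV indV ih ltr01.
apply: whp_sub => B w; rewrite -/(weighted_mean q B (V ^~ w) h) -/c => /ltW.
rewrite ler_norml => /andP[_]; rewrite lerBlDl => /le_trans; apply.
by rewrite lerD2r ler_norm.
Qed.

Variables (U : set 'rV[R]_n) (g : 'rV[R]_n -> X -> R).
Hypothesis oU : open U.
Hypothesis g_regular : regular_density m U g.
Hypothesis g_int : forall t, U t -> m.-integrable setT (EFin \o g t).
Hypothesis g_one : forall t, U t -> \int[m]_x g t x = 1.
Hypothesis g_zero : forall t x, U t -> q x = 0 -> g t x = 0.

Let g_smooth x : smooth U 3 (g ^~ x) := rd_smooth g_regular x.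

(** The zero set of [q] does not depend on [t], so [g ^~ x] is identically 0 on the open set [U] for
    such an [x]. *)
Lemma partial_zero i t x : U t -> q x = 0 -> partial i (g ^~ x) t = 0.
Proof.
move=> Ut qx; rewrite (open_eq_partial (G := cst 0) _ oU)//.
  exact: partial_cst.
by move=> u Uu; exact: g_zero.
Qed.

Lemma partial2_zero i j t x : U t -> q x = 0 ->
  partial i (partial j (g ^~ x)) t = 0.
Proof.
move=> Ut qx; rewrite (open_eq_partial (G := cst 0) _ oU)//.
  exact: partial_cst.
by move=> u Uu; exact: partial_zero.
Qed.

Lemma integral_partial i t : U t -> \int[m]_x partial i (g ^~ x) t = 0.
Proof.
move=> Ut; have [_ <-] := rd_diff1 g_regular i Ut.
rewrite (open_eq_partial (G := cst 1) _ oU)//; first exact: partial_cst.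
Qed.

Lemma integral_partial2 i j t : U t ->
  \int[m]_x partial i (partial j (g ^~ x)) t = 0.
Proof.
move=> Ut; have [_ <-] := rd_diff2 g_regular i j Ut.
rewrite (open_eq_partial (G := cst 0) _ oU)//; first exact: partial_cst.
move=> u Uu; rewrite (open_eq_partial (G := cst 1) _ oU)//; exact: partial_cst.
Qed.

Lemma weighted_mean_partial B s i t : U t ->
  is_derive t (delta_mx ord0 i) (fun u => weighted_mean q B s (g u))
    (weighted_mean q B s (fun x => partial i (g ^~ x) t)).
Proof.
move=> Ut; apply: is_derive_weighted_sum => b.
exact: smooth_derivable (g_smooth _) Ut.
Qed.

Lemma weighted_mean_partial2 B s i j t : U t ->
  is_derive t (delta_mx ord0 i) (partial j (fun u => weighted_mean q B s (g u)))
    (weighted_mean q B s (fun x => partial i (partial j (g ^~ x)) t)).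
Proof.
move=> Ut.
have h : is_derive t (delta_mx ord0 i)
    (fun u => weighted_mean q B s (fun x => partial j (g ^~ x) u))
    (weighted_mean q B s (fun x => partial i (partial j (g ^~ x)) t)).
  apply: is_derive_weighted_sum => b.
  exact: smooth_derivable (smooth_partial j (g_smooth _)) Ut.
apply: near_eq_is_derive h; near=> u; apply/esym.
have Uu : U u by near: u; exact: open_nbhs_nbhs.
by have [_] := weighted_mean_partial B s j Uu.
Unshelve. all: by end_near. Qed.

(** On the box, averages at [t] differ from those at [c] by at most [n%:R * r] times an averaged
    Lipschitz constant. A small [r], chosen independently of the sample size, makes this at most
    [e / 2]; the pointwise law at [c] supplies the other half. *)
Lemma local_uniform_lln (c : 'rV[R]_n) (e : R) : U c -> 0 < e ->
  exists r : R, [/\ 0 < r,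
    forall t : 'rV[R]_n, (forall i, `|t ord0 i - c ord0 i| < r) -> U t &
    whp P (fun B w => let mean := weighted_mean q B (V ^~ w) in
      forall t : 'rV[R]_n, (forall i, `|t ord0 i - c ord0 i| < r) ->
      [/\ `|mean (g t) - 1| < e,
          forall i, `|mean (fun x => partial i (g ^~ x) t)| < e &
          forall i j, `|mean (fun x => partial i (partial j (g ^~ x)) t)| < e])].
Proof.
move=> Uc e0; have e20 : 0 < e / 2 by rewrite divr_gt0.
have [M [iM bM]] := rd_dom3 g_regular.
have [rho' rho'0 rho'U] := row_nbhs_box (open_nbhs_nbhs (conj oU Uc)).
pose rho := Num.min rho' 1.
have rho0 : 0 < rho by rewrite lt_min rho'0 ltr01.
have rho1 : rho <= 1 by rewrite ge_min lexx orbT.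
have rhoU (t : 'rV[R]_n) : (forall i, `|t ord0 i - c ord0 i| < rho) -> U t.
  by move=> ht; apply: rho'U => i; apply: lt_le_trans (ht i) _; rewrite ge_min lexx.
pose A0 x := `|M x|.
pose A2 x := second_order_const (g ^~ x) c (A0 x).
pose A1 x := first_order_const (g ^~ x) c (A0 x).
have iA0 : m.-integrable setT (EFin \o A0) by exact: integrable_norm.
have iA2 : m.-integrable setT (EFin \o A2).
  apply: integrableRD; last exact: integrableRZ.
  apply: (Rintegral_sum _ _).1 => i; apply: (Rintegral_sum _ _).1 => j.
  apply: (integrable_norm (f := fun x => partial i (partial j (g ^~ x)) c)).
  by have [] := rd_diff2 g_regular i j Uc.
have iA1 : m.-integrable setT (EFin \o A1).
  apply: integrableRD; last exact: integrableRZ.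
  apply: (Rintegral_sum _ _).1 => i.
  apply: (integrable_norm (f := fun x => partial i (g ^~ x) c)).
  by have [] := rd_diff1 g_regular i Uc.
have [C0 C00 h0] := weighted_mean_whp_bounded iA0.
have [C1 C10 h1] := weighted_mean_whp_bounded iA1.
have [C2 C20 h2] := weighted_mean_whp_bounded iA2.
(* [C] bounds the three averages at once; [r <= e / 2 / D] then gives [n%:R * r * C <= e / 2], and
   the [+ 1] in [D] keeps the divisor positive. *)
pose C := C0 + C1 + C2.
have C_ge0 : 0 <= C by rewrite !addr_ge0.
pose D := n%:R * C + 1.
have D0 : 0 < D by rewrite ltr_wpDl// mulr_ge0.
pose r := Num.min rho (e / 2 / D).
have r0 : 0 < r by rewrite lt_min rho0 divr_gt0.
have rrho : r <= rho by rewrite ge_min lexx.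
have nrC : n%:R * r * C <= e / 2.
  have : r * D <= e / 2 by rewrite -ler_pdivlMr// ge_min lexx orbT.
  apply: le_trans; rewrite mulrAC mulrC ler_wpM2l ?(ltW r0)// /D lerDl.
  exact: ler01.
have nr0 : 0 <= n%:R * r by rewrite mulr_ge0// ltW.
exists r; split=> //.
  by move=> t ht; apply: rhoU => i; exact: lt_le_trans (ht i) rrho.
have k0 := importance_sampling_lln mq q0 mV lawV indV
  (g_int Uc) (fun x => @g_zero c x Uc) e20.
have k1 := whp_forall (fun i => importance_sampling_lln mq q0 mV lawV indV
  (rd_diff1 g_regular i Uc).1 (fun x => @partial_zero i c x Uc) e20).
have k2 := whp_forall (fun ij : 'I_n * 'I_n =>
  importance_sampling_lln mq q0 mV lawV indV (rd_diff2 g_regular ij.1 ij.2 Uc).1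
    (fun x => @partial2_zero ij.1 ij.2 c x Uc) e20).
(* From here on everything is deterministic: a finite conjunction of events at [c] implies the
   estimates at all [t] of the box simultaneously. *)
apply: whp_sub
  (whp_and (whp_and h0 (whp_and h1 h2)) (whp_and k0 (whp_and k1 k2))).
move=> B w [[H0 [H1 H2]] [K0 [K1 K2]]] mean t ht.
have lip x := @smooth3_local_lipschitz R n U (g ^~ x) c (A0 x) rho (g_smooth x)
  (normr_ge0 _) (fun i j k u Uu => le_trans (bM u x i j k Uu) (ler_norm _))
  rho1 rhoU r t.
have {}lip x := lip x (introT andP (conj r0 rrho)) ht.
have close (s u A : X -> R) (l : R) :
    (forall x, `|s x - u x| <= n%:R * (A x * r)) ->
    mean A <= C -> `|mean u - l| < e / 2 -> `|mean s - l| < e.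
  move=> hsu hA hu.
  have su : `|mean s - mean u| <= n%:R * r * mean A.
    apply: (@weighted_mean_close _ _ (fun b : 'I_B => s (V b w))
      (fun b => u (V b w)) (fun b => A (V b w))
      (fun b => (q (V b w))^-1)) => // b.
      by rewrite invr_ge0.
    by rewrite mulrAC -mulrA.
  have : n%:R * r * mean A <= e / 2 by apply: le_trans nrC; rewrite ler_wpM2l.
  have := ler_distD (mean u) (mean s) l; move: su hu; lra.
have CC0 : C0 <= C by rewrite /C -addrA lerDl addr_ge0.
have CC1 : C1 <= C by rewrite /C addrAC lerDr addr_ge0.
have CC2 : C2 <= C by rewrite /C lerDr addr_ge0.
split=> [|i|i j].
- apply: (close _ (g c) A1) => [x||]; first by have [] := lip x.
    exact: le_trans CC1.
  by move: K0; rewrite g_one.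
- rewrite -[X in `|X|]subr0.
  apply: (close _ (fun x => partial i (g ^~ x) c) A2) => [x||].
  + by have [_ + _] := lip x; exact.
  + exact: le_trans CC2.
  + by move: (K1 i); rewrite integral_partial.
- rewrite -[X in `|X|]subr0.
  apply: (close _ (fun x => partial i (partial j (g ^~ x)) c) A0) => [x||].
  + by have [_ _] := lip x; exact.
  + exact: le_trans CC0.
  + by move: (K2 (i, j)); rewrite /= integral_partial2.
Qed.

End local_uniform_lln.

(** * Consistency of maximizers *)

Section argmax_consistency.
Context (R : realType) (dT : measure_display) (T : measurableType dT)
  (P : probability T R) (W : normedModType R).

(* [near_covering] along this filter replaces the extraction of a finite
   subcover. *)
Definition whp_filter : set_system (nat * T) :=
  [set A | whp P (fun n w => A (n, w))].

Lemma whp_filterP : Filter whp_filter.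
Proof.
split; first exact: whp_true.
- by move=> A B; exact: whp_and.
- by move=> A B AB; apply: whp_sub => n w; exact: AB.
Qed.

Variables (S : set W) (H : W -> R) (x0 : W) (X : nat -> T -> W)
  (err : nat -> T -> W -> R).
Hypothesis X_tight : tight_in P S X.
Hypothesis H_cont : forall x, S x -> {for x, continuous H}.
Hypothesis H_max : forall x, S x -> x != x0 -> H x < H x0.
Hypothesis err_x0 : forall e, 0 < e -> whp P (fun n w => `|err n w x0| < e).
Hypothesis err_local : forall x e, S x -> 0 < e -> exists2 U, nbhs x U &
  whp P (fun n w => forall z, U z -> `|err n w z| < e).
Hypothesis X_argmax : whp P (fun n w =>
  H x0 + err n w x0 <= H (X n w) + err n w (X n w)).

(** With [g] a third of the gap, the perturbed objective near [x] stays below [H x + 3 * g - g],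
    that is [H x0 - g], while at [x0] it exceeds [H x0 - g]. *)
Let whp_avoid x : S x -> x != x0 ->
  exists2 U, nbhs x U & whp P (fun n w => ~ U (X n w)).
Proof.
move=> Sx xx0; pose g := (H x0 - H x) / 3.
have g0 : 0 < g by rewrite divr_gt0// subr_gt0 H_max.
have [U nU hU] := err_local Sx g0.
have /cvgrPdist_lt/(_ _ g0) nH := H_cont Sx.
exists (U `&` [set z | `|H x - H z| < g]); first exact: filterI.
apply: whp_sub (whp_and hU (whp_and (err_x0 g0) X_argmax)).
move=> n w [h1 [h2 h3]] [/= Uz]; have := h1 _ Uz; move: h2 h3.
by rewrite /g !ltr_norml => /andP[? ?] ? /andP[? ?] /andP[? ?]; lra.
Qed.

(** Tightness confines [X n] to a compact [C]. The part of [C] outside the ball around [x0] is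
    compact, and each of its points has a neighbourhood that is avoided with high probability. *)
Lemma argmax_whp_near (e : R) : 0 < e -> whp P (fun n w => `|X n w - x0| < e).
Proof.
move=> e0 d d0; have d20 : 0 < d / 2 by rewrite divr_gt0.
have [C [cC CS hC]] := X_tight d20.
pose K := C `&` [set x | e <= `|x - x0|].
have cK : compact K.
  apply: compact_closedI => //.
  rewrite (_ : [set x | _] = ~` ball x0 e).
    by apply: open_closedC; exact: ball_open.
  by apply/seteqP; split => x; rewrite -ball_normE /= distrC leNgt => /negP.
have hK : whp P (fun n w => forall x, K x -> X n w <> x).
  have := (compact_near_coveringP K).1 cK _ _
    (fun (i : nat * T) x => X i.1 i.2 <> x) whp_filterP.
  apply=> x [/CS Sx ex].
  have xx0 : x != x0.
    apply: contraTneq e0 => xx0.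
    by rewrite -leNgt (le_trans ex)// xx0 subrr normr0.
  have [U nU hU] := whp_avoid Sx xx0.
  exists (U, [set i | ~ U (X i.1 i.2)]); first by split.
  by move=> [z [n w]] [/= Uz hz] Xz; apply: hz; rewrite Xz.
near=> n.
rewrite (_ : d = d / 2 + d / 2); last by field.
have h1 : (mu_ext P [set w | ~ C (X n w)] <= (d / 2)%:E)%E by near: n; exact: hC.
have h2 : (mu_ext P [set w | ~ (forall x, K x -> X n w <> x)] <= (d / 2)%:E)%E.
  by near: n; exact: hK.
rewrite EFinD; apply: le_trans (leeD h1 h2).
apply: le_trans (mu_ext_orP _ _ _); apply: le_mu_ext => w.
apply: contra_not => -[CX KX]; rewrite ltNge; apply/negP => eX.
by apply: (KX (X n w)).
Unshelve. all: by end_near. Qed.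

(** [x0] lies in the closure of the compact [C]: otherwise some ball around [x0] misses [C], and
    [X n] could never be in both, although the outer probabilities of leaving them add up to less
    than 1. *)
Lemma argmax_in_tight : S x0.
Proof.
have h20 : (0 : R) < 2^-1 by rewrite invr_gt0.
have h40 : (0 : R) < 4^-1 by rewrite invr_gt0.
have [C [cC CS hC]] := X_tight h20; apply: CS.
have /closure_id -> : closed C.
  by apply: compact_closed => //; exact: norm_hausdorff.
move=> U /nbhs_ballP[e /= e0 eU].
have hX := argmax_whp_near e0 h40.
apply: contrapT => CU0.
suff : (1 <= (2^-1 + 4^-1)%:E :> \bar R)%E by rewrite lee_fin; lra.
have [n [h1 h2]] : exists n, (mu_ext P [set w | ~ C (X n w)] <= 2^-1%:E)%E /\
    (mu_ext P [set w | ~ (`|X n w - x0| < e)%R] <= 4^-1%:E)%E.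
  have [N _ hN] : \forall n \near \oo,
      (mu_ext P [set w | ~ C (X n w)] <= 2^-1%:E)%E /\
      (mu_ext P [set w | ~ (`|X n w - x0| < e)%R] <= 4^-1%:E)%E.
    exact: filterI.
  by exists N; apply: hN; exact: leqnn.
rewrite EFinD; apply: le_trans (leeD h1 h2); apply: le_trans (mu_ext_orP _ _ _).
rewrite -(probability_setT P) -measurable_mu_extE//.
apply: le_mu_ext => w _ [CX xX]; apply: CU0; exists (X n w); split=> //.
by apply: eU; rewrite -ball_normE /= distrC.
Qed.

End argmax_consistency.

(** * Hessian of the approximate h-likelihood *)

(** The expression is an entry of the Hessian of [ln G]. As [2^-1 <= g], each term is at most
    [2 * e], the second using also [|b| <= 2^-1]; the constant 8 is generous and yields
    strictness. *)
Lemma log_hessian_bound (R : realFieldType) (g a b c e : R) :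
  0 < e -> e <= 2^-1 -> `|g - 1| < e -> `|a| < e -> `|b| < e -> `|c| < e ->
  `|c / g - a * b / g ^+ 2| < 8 * e.
Proof.
move=> e0 e2 hg ha hb hc.
have g2 : 2^-1 <= g by move: hg; rewrite ltr_norml => /andP[]; lra.
have g0 : 0 < g by apply: lt_le_trans g2; rewrite invr_gt0.
have gi : g^-1 <= 2 by rewrite -[leRHS]invrK lef_pV2// posrE invr_gt0.
have gi0 : 0 <= g^-1 by rewrite invr_ge0 ltW.
have h1 : `|c / g| <= 2 * e.
  by rewrite normrM (ger0_norm gi0) mulrC ler_pM// ltW.
have h2 : `|a * b / g ^+ 2| <= 2 * e.
  have -> : a * b / g ^+ 2 = a * (b * (g^-1 * g^-1)) by field; rewrite gt_eqF.
  rewrite normrM mulrC; apply: ler_pM => //; last exact: ltW.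
  have gg0 : 0 <= g^-1 * g^-1 by rewrite mulr_ge0.
  rewrite normrM (ger0_norm gg0).
  apply: (@le_trans _ _ (2^-1 * (2 * 2))); last by lra.
  have b2 : `|b| <= 2^-1 by apply: ltW; exact: lt_le_trans e2.
  have gg : g^-1 * g^-1 <= 2 * 2 by exact: ler_pM.
  exact: ler_pM.
have := ler_normB (c / g) (a * b / g ^+ 2).
move: h1 h2 e0; lra.
Qed.

Lemma is_derive_partial_ln (R : realType) n (U : set 'rV[R]_n)
    (G : 'rV[R]_n -> R)
    (i j : 'I_n) (t : 'rV[R]_n) :
  open U -> U t -> (forall u, U u -> 0 < G u) ->
  (forall k u, U u -> derivable G u (delta_mx ord0 k)) ->
  derivable (partial j G) t (delta_mx ord0 i) ->
  is_derive t (delta_mx ord0 i) (partial j (fun u => ln (G u)))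
    (partial i (partial j G) t / G t - partial i G t * partial j G t / G t ^+ 2).
Proof.
move=> oU Ut G0 dG dG2; have Gt0 : G t != 0 by rewrite gt_eqF// G0.
have dV : is_derive t (delta_mx ord0 i) (fun u => (G u)^-1)
    (- (G t) ^- 2 *: partial i G t).
  by apply: DeriveDef; [exact: derivableV (dG i t Ut) | exact: deriveV (dG i t Ut)].
have dP : is_derive t (delta_mx ord0 i) (partial j G)
    (partial i (partial j G) t).
  exact: DeriveDef.
have := is_deriveM dP dV.
rewrite (_ : _ *: (_ *: _) + _ = partial i (partial j G) t / G t -
    partial i G t * partial j G t / G t ^+ 2).
  apply: near_eq_is_derive; near=> u.
  have Uu : U u by near: u; exact: open_nbhs_nbhs.
  have [_ h] := is_derive_ln_comp (G0 u Uu) (DeriveDef (dG j u Uu) erefl).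
  exact: esym h.
rewrite -[X in X + _]/(partial j G t * (- G t ^- 2 * partial i G t)).
rewrite -[X in _ + X]/((G t)^-1 * partial i (partial j G) t).
by field.
Unshelve. all: by end_near. Qed.

Section left_block.
Context (R : realType) (p d : nat).
Implicit Types (F : 'rV[R]_p -> R) (x v : 'rV[R]_(p + d)).

Let lsubmx_line (h : R) x v : lsubmx (h *: v + x) = h *: lsubmx v + lsubmx x.
Proof. by apply/rowP => i; rewrite !mxE. Qed.

Lemma derive_lsubmx F x v :
  'D_v (fun z : 'rV[R]_(p + d) => F (lsubmx z)) x = 'D_(lsubmx v) F (lsubmx x).
Proof.
rewrite /derive /=.
by under eq_fun do rewrite lsubmx_line.
Qed.

Lemma derivable_lsubmx F x v : derivable F (lsubmx x) (lsubmx v) ->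
  derivable (fun z : 'rV[R]_(p + d) => F (lsubmx z)) x v.
Proof.
rewrite /derivable /=.
by under [X in _ -> cvg (X @ _)]eq_fun do rewrite lsubmx_line.
Qed.

(** The derivative is 0 in the last [d] directions. The result is again a function on ['rV_p], so
    the rule can be iterated for second derivatives. *)
Definition left_partial (j : 'I_(p + d)) F : 'rV[R]_p -> R :=
  if fintype.split j is inl j' then partial j' F else cst 0.

Lemma lsubmx_delta (j : 'I_(p + d)) :
  lsubmx (delta_mx ord0 j : 'rV[R]_(p + d)) =
  if fintype.split j is inl j' then delta_mx ord0 j' else 0.
Proof.
case: fintype.splitP => k jk; apply/rowP => i; rewrite !mxE /=.
  by rewrite -!val_eqE /= jk.
by rewrite -val_eqE /= jk ltn_eqF// ltn_addr.
Qed.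

Lemma partial_lsubmx (j : 'I_(p + d)) F :
  partial j (fun z : 'rV[R]_(p + d) => F (lsubmx z)) =
  (fun z => left_partial j F (lsubmx z)).
Proof.
apply/funext => z; rewrite /left_partial /partial derive_lsubmx lsubmx_delta.
by case: fintype.split => // k; exact: derive0.
Qed.

Lemma derivable_lsubmx_partial (j : 'I_(p + d)) F x :
  (forall k, derivable F (lsubmx x) (delta_mx ord0 k)) ->
  derivable (fun z : 'rV[R]_(p + d) => F (lsubmx z)) x (delta_mx ord0 j).
Proof.
move=> dF; apply: derivable_lsubmx; rewrite lsubmx_delta.
by case: fintype.split => // k; exact: derivable0.
Qed.

Lemma open_joint_set (A : set 'rV[R]_p) (B : set 'rV[R]_d) :
  open A -> open B -> open (joint_set A B).
Proof.
move=> oA oB; rewrite openE => x [Ax Bx].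
have [r r0 hr] := row_nbhs_box (open_nbhs_nbhs (conj oA Ax)).
have [s s0 hs] := row_nbhs_box (open_nbhs_nbhs (conj oB Bx)).
have rs0 : 0 < Num.min r s by rewrite lt_min r0.
apply: filterS (row_box_nbhs x rs0) => z hz; split.
  apply: hr => i; rewrite !mxE; apply: lt_le_trans (hz _) _.
  by rewrite ge_min lexx.
apply: hs => i; rewrite !mxE; apply: lt_le_trans (hz _) _.
by rewrite ge_min lexx orbT.
Qed.

End left_block.

Lemma open_box (R : realType) n (c : 'rV[R]_n) (r : R) : 0 < r ->
  open [set x : 'rV[R]_n | forall i, `|x ord0 i - c ord0 i| < r].
Proof.
move=> r0; rewrite (_ : mkset _ = ball c r); first exact: ball_open.
apply/seteqP; split => [x hx|x [_ hx] i]; last first.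
  by have := hx ord0 i; rewrite /ball /= distrC.
by split=> // i j; rewrite ord1 /ball /= distrC.
Qed.

Lemma mx_norm_lt (R : realType) m n (A : 'M[R]_(m, n)) (e : R) : 0 < e ->
  (forall i j, `|A i j| < e) -> `|A| < e.
Proof.
move=> e0 hA; have : ball (0 : 'M[R]_(m, n)) e A.
  by split=> // i j; rewrite /ball /= mxE sub0r normrN.
by rewrite -ball_normE /= sub0r normrN.
Qed.

Lemma partialD (R : realType) n (U : set 'rV[R]_n) (F G H : 'rV[R]_n -> R) i x :
  open U -> (forall z, U z -> F z = G z + H z) -> U x ->
  derivable G x (delta_mx ord0 i) -> derivable H x (delta_mx ord0 i) ->
  partial i F x = partial i G x + partial i H x.
Proof.
move=> oU FE Ux dG dH; rewrite (open_eq_partial (G := G + H) i oU FE Ux).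
exact: deriveD.
Qed.

(* The correction [ln (G (lsubmx z))] only contributes to the block of
   derivatives in the first [p] variables. *)
Lemma hessian_add_ln (R : realType) p d (U : set 'rV[R]_p) (O : set 'rV[R]_d)
    (F H : 'rV[R]_(p + d) -> R) (G : 'rV[R]_p -> R) (e : R)
    (x : 'rV[R]_(p + d)) :
  open U -> open O -> joint_set U O x -> smooth (joint_set U O) 3 H ->
  (forall z, U (lsubmx z) -> F z = H z + ln (G (lsubmx z))) ->
  0 < e <= 2^-1 ->
  (forall i u, U u -> derivable G u (delta_mx ord0 i)) ->
  (forall i j u, U u -> derivable (partial j G) u (delta_mx ord0 i)) ->
  (forall u, U u -> [/\ `|G u - 1| < e, forall i, `|partial i G u| < e &
     forall i j, `|partial i (partial j G) u| < e]) ->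
  forall i j,
    `|partial i (partial j F) x - partial i (partial j H) x| < 8 * e.
Proof.
move=> oU oO [Ux Ox] sH FE /andP[e0 e2] dG dG2 bG i j.
have oJ := open_joint_set oU oO.
have G0 u : U u -> 0 < G u.
  by move=> /bG[]; rewrite ltr_norml => /andP[]; lra.
have dln u k : U u -> derivable (fun t => ln (G t)) u (delta_mx ord0 k).
  move=> Uu.
  by have [] := is_derive_ln_comp (G0 u Uu) (DeriveDef (dG k u Uu) erefl).
have d2ln u k l : U u ->
    is_derive u (delta_mx ord0 k) (partial l (fun t => ln (G t)))
      (partial k (partial l G) u / G u -
       partial k G u * partial l G u / G u ^+ 2).
  by move=> Uu; exact: (is_derive_partial_ln oU Uu G0 dG (dG2 k l u Uu)).
(* Established on the whole open set and not only at [x], because this identity is differentiated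
   once more in [p2]. *)
have p1 z k : joint_set U O z -> partial k F z =
    partial k H z + left_partial k (fun t => ln (G t)) (lsubmx z).
  move=> Jz; have [Uz Oz] := Jz.
  rewrite (partialD oJ (fun z' (hz : joint_set U O z') => FE z' hz.1) Jz).
  - by rewrite (partial_lsubmx k (fun t => ln (G t))).
  - exact: smooth_derivable sH Jz.
  - by apply: (derivable_lsubmx_partial (F := fun t => ln (G t))) => l; exact: dln.
have p2 : partial i (partial j F) x = partial i (partial j H) x +
    left_partial i (left_partial j (fun t => ln (G t))) (lsubmx x).
  rewrite (partialD oJ (fun z' (hz : joint_set U O z') => p1 z' j hz)
    (conj Ux Ox)).
  - by rewrite (partial_lsubmx i (left_partial j (fun t => ln (G t)))).
  - exact: smooth_derivable (smooth_partial j sH) (conj Ux Ox).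
  - apply: (derivable_lsubmx_partial (F := left_partial j (fun t => ln (G t)))).
    move=> l; rewrite /left_partial.
    case: fintype.split => [k|_]; last exact: derivable_cst.
    by have [] := d2ln _ l k Ux.
have aK (a b : R) : a + b - a = b by ring.
rewrite p2 aK /left_partial.
case: (fintype.split i) => [k|_]; last by rewrite normr0 mulr_gt0.
case: (fintype.split j) => [l|_]; last by rewrite partial_cst normr0 mulr_gt0.
have [_ D] := d2ln _ k l Ux; rewrite [partial k _ _]D.
have [h0 h1 h2] := bG _ Ux.
exact: log_hessian_bound e0 e2 h0 (h1 k) (h1 l) (h2 k l).
Qed.

(** If the integral were 0, [f] would vanish almost everywhere and with it [q], which has mass 1.
    With the proposal as [q] this makes the likelihood positive. *)
Lemma Rintegral_gt0 (R : realType) d (X : measurableType d)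
    (m : {measure set X -> \bar R}) (f q : X -> R) :
  m.-integrable setT (EFin \o f) -> (forall x, 0 <= f x) ->
  measurable_fun setT q -> (\int[m]_x (q x)%:E = 1)%E ->
  (forall x, f x = 0 -> q x = 0) -> 0 < \int[m]_x f x.
Proof.
move=> iF f0 mq q1 fq.
rewrite lt_def Rintegral_ge0 ?andbT//; apply/eqP => F0.
have mf : measurable_fun setT (EFin \o f) := measurable_int _ iF.
have hf : (\int[m]_x `|(EFin \o f) x| = 0)%E.
  transitivity (\int[m]_x (f x)%:E)%E.
    by apply: eq_integral => x _; rewrite /= ger0_norm.
  by rewrite -[LHS]fineK ?integrable_fin_num//; congr EFin.
have /(ae_eq_integral_abs m measurableT mf) f_ae := hf.
have q_ae : ae_eq m setT (EFin \o q) (cst 0%E).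
  by apply: filterS f_ae => x /= h /h[/fq ->].
have : (\int[m]_x (q x)%:E = 0)%E.
  rewrite (ae_eq_integral (cst 0%E))//; first exact: integral0.
  exact/measurable_EFinP.
by rewrite q1 => /eqP; rewrite onee_eq0.
Qed.

(** The extra bound [r <= 2^-1] keeps [u] positive, as splitting the logarithm of a product
    requires. *)
Lemma ln_near1 (R : realType) (e : R) : 0 < e ->
  exists2 r, 0 < r <= 2^-1 & forall u : R, `|u - 1| < r -> `|ln u| < e.
Proof.
move=> e0; have /cvgrPdist_lt/(_ _ e0)[r /= r0 hr] := continuous_ln (@ltr01 R).
exists (Num.min r 2^-1).
  by rewrite lt_min r0 invr_gt0 ltr0n ge_min lexx orbT.
move=> u hu; have : `|1 - u| < r.
  by rewrite distrC; apply: lt_le_trans hu _; rewrite ge_min lexx.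
by move=> /hr; rewrite /= ln1 sub0r normrN.
Qed.

(** * Consistency of the approximate MHLEs and of the approximate h-information *)

Theorem theorem6 (R : realType) (p d : nat)
    (dY : measure_display) (Y : measurableType dY)
    (mu : {sigma_finite_measure set Y -> \bar R})
    (nu : {sigma_finite_measure set (borelV R d) -> \bar R})
    (nu_lebesgue : is_lebesgue nu)
    (Theta Tstar : set 'rV[R]_p) (theta0 : 'rV[R]_p)
    (Oy : set Y) (Ov : set 'rV[R]_d)
    (f : 'rV[R]_p -> Y -> 'rV[R]_d -> R)
    (vt : 'rV[R]_p -> Y -> 'rV[R]_d)
    (vt_argmax : forall theta y, Theta theta -> Oy y ->
      is_argmax Ov (fun v => ln (f theta y v)) (vt theta y))
    (f_regular : regular mu nu Theta Tstar theta0 Oy Ov f (hlik nu f vt))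
    (y : Y) (y_obs : Oy y)
    (q : 'rV[R]_d -> R) (q_proposal : is_proposal nu Ov q)
    (dT : measure_display) (T : measurableType dT) (P : probability T R)
    (V : nat -> T -> 'rV[R]_d) (V_iid : iid_from P nu q V)
    (thetah : 'rV[R]_p) (vh : 'rV[R]_d)
    (mhle : is_argmax (joint_set Theta Ov) (joint (hlik nu f vt y))
      (row_mx thetah vh))
    (mhle_uniq : forall x,
      is_argmax (joint_set Theta Ov) (joint (hlik nu f vt y)) x ->
      x = row_mx thetah vh)
    (thetaB : nat -> T -> 'rV[R]_p) (vB : nat -> T -> 'rV[R]_d)
    (mhleB : \forall B \near \oo, {ae P, forall w,
      is_argmax (joint_set Theta Ov)
        (joint (hlik_mc f vt q y B (fun b => V b w)))
        (row_mx (thetaB B w) (vB B w))})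
    (mhleB_tight : tight_in P (joint_set Tstar Ov)
      (fun B w => row_mx (thetaB B w) (vB B w))) :
  cvg_in_prob P (fun B w => row_mx (thetaB B w) (vB B w)) (row_mx thetah vh) /\
  cvg_in_prob P
    (fun B w => information (hlik_mc f vt q y B (fun b => V b w))
                  (thetaB B w) (vB B w))
    (information (hlik nu f vt y) thetah vh).
Proof.
have [oT sT _ mdl _ _ _ /(_ y y_obs) rg /(_ y y_obs) sh _ _ _ _] := f_regular.
have [q0 mq q1 qO] := q_proposal.
have [mV lawV indV] := V_iid.
have fO theta v : Theta theta -> q v = 0 -> f theta y v = 0.
  move=> Tt qv; apply/eqP; rewrite eq_le (model_ge0 mdl y v Tt) andbT leNgt.
  apply/negP => /(model_supp mdl y v Tt)[_ /qO]; by rewrite qv ltxx.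
have qf theta v : Theta theta -> f theta y v = 0 -> q v = 0.
  move=> Tt fv; apply/eqP; rewrite eq_le q0 andbT leNgt; apply/negP => /qO Ov_v.
  by have /(model_supp mdl y v Tt) : Oy y /\ Ov v by []; rewrite fv ltxx.
pose L theta := dens_y nu f theta y.
have L0 theta : Theta theta -> 0 < L theta.
  move=> Tt; apply: (Rintegral_gt0 (model_int_v mdl Tt y_obs) _ mq q1) => v.
    exact: (model_ge0 mdl y v Tt).
  exact: qf.
pose g theta v := dens_v_y nu f theta y v.
have gE theta v : g theta v = (L theta)^-1 * f theta y v by rewrite mulrC.
have g_int theta : Theta theta -> nu.-integrable setT (EFin \o g theta).
  move=> Tt; have := integrableRZ (L theta)^-1 (model_int_v mdl Tt y_obs).
  by congr integrable; apply/funext => v /=; rewrite gE.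
have g_one theta : Theta theta -> \int[nu]_v g theta v = 1.
  move=> Tt; under eq_Rintegral do rewrite gE.
  rewrite RintegralZl//; last exact: (model_int_v mdl Tt y_obs).
  by rewrite mulVf// gt_eqF// L0.
have g_zero theta v : Theta theta -> q v = 0 -> g theta v = 0.
  by move=> Tt qv; rewrite gE fO ?mulr0.
pose mean B s theta := weighted_mean q B s (g theta).
have likE B s theta : Theta theta ->
    lik_mc f q y B s theta = L theta * mean B s theta.
  move=> Tt; rewrite /lik_mc /mean /weighted_mean mulrCA; congr (_ * _).
  rewrite mulr_sumr; apply: eq_bigr => b _; rewrite gE mulrA mulrA.
  by rewrite divff ?mul1r// gt_eqF// L0.
pose H := joint (hlik nu f vt y).
pose HB B w := joint (hlik_mc f vt q y B (fun b => V b w)).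
have HBE B w x : Theta (lsubmx x) -> 0 < mean B (V ^~ w) (lsubmx x) ->
    HB B w x = H x + ln (mean B (V ^~ w) (lsubmx x)).
  move=> Tx m0; rewrite /HB /H /joint /hlik_mc /hlik likE// lnM ?posrE ?L0//.
  by rewrite addrA.
have mean0 (u r : R) : r <= 2^-1 -> `|u - 1| < r -> 0 < u.
  by rewrite ltr_norml => r2 /andP[]; lra.
(* Defined as a difference and not as the logarithm of the average, so that the argmax inequality is
   exact even for samples whose average is not positive. *)
pose err B w x := HB B w x - H x.
have errE B w x : Theta (lsubmx x) -> 0 < mean B (V ^~ w) (lsubmx x) ->
    err B w x = ln (mean B (V ^~ w) (lsubmx x)).
  by move=> Tx m0; rewrite /err HBE// addrAC subrr add0r.
set x0 : 'rV[R]_(p + d) := row_mx thetah vh.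
pose X B w : 'rV[R]_(p + d) := row_mx (thetaB B w) (vB B w).
have [Th Hmax] := mhle; have {Th}[Tx0 Ox0] := Th.
have g_zero' theta v : Tstar theta -> q v = 0 -> g theta v = 0.
  by move=> /sT; exact: g_zero.
have lln_loc := local_uniform_lln mq q0 mV lawV indV oT rg
  (fun t Ut => g_int t (sT t Ut)) (fun t Ut => g_one t (sT t Ut)) g_zero'.
have H_cont x : joint_set Tstar Ov x -> {for x, continuous H}.
  exact: smooth_continuous sh.
(* A competitor with [H x0 <= H x] would itself maximize over [Theta], against uniqueness. *)
have H_max x : joint_set Tstar Ov x -> x != x0 -> H x < H x0.
  move=> [/sT Tx Ox] xx0; rewrite ltNge; apply/negP => Hx.
  move/eqP: xx0; apply; apply: mhle_uniq; split=> // z /Hmax Hz.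
  exact: le_trans Hz Hx.
(* So far [thetah] is only known to lie in [Theta], hence the pointwise law instead of the locally
   uniform one. *)
have err_x0 e : 0 < e -> whp P (fun B w => `|err B w x0| < e).
  move=> e0; have [r /andP[r0 r2] hr] := ln_near1 e0.
  have := importance_sampling_lln mq q0 mV lawV indV (g_int _ Tx0)
    (fun v => g_zero _ v Tx0) r0.
  rewrite (g_one _ Tx0); apply: whp_sub => B w hB.
  by rewrite errE//; [exact: hr | exact: mean0 r2 hB].
have err_loc x e : joint_set Tstar Ov x -> 0 < e -> exists2 U, nbhs x U &
    whp P (fun B w => forall z, U z -> `|err B w z| < e).
  move=> [Tx Ox] e0; have [r /andP[r0 r2] hr] := ln_near1 e0.
  have [s [s0 sU hs]] := lln_loc _ _ Tx r0.
  exists [set z | forall i, `|z ord0 i - x ord0 i| < s]; first exact: row_box_nbhs.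
  apply: whp_sub hs => B w hB z hz.
  have zs i : `|lsubmx z ord0 i - lsubmx x ord0 i| < s by rewrite !mxE.
  have [h _ _] := hB _ zs.
  by rewrite errE; [exact: hr | exact/sT/sU | exact: mean0 r2 h].
have X_argmax : whp P (fun B w =>
    H x0 + err B w x0 <= H (X B w) + err B w (X B w)).
  apply: whp_ae; apply: filterS mhleB => B; apply: filterS => w [_ hw].
  by rewrite /err !(addrC (H _)) !subrK; exact: hw.
have X_near := argmax_whp_near mhleB_tight H_cont H_max err_x0 err_loc X_argmax.
have [Ts0 Os0] :=
  argmax_in_tight mhleB_tight H_cont H_max err_x0 err_loc X_argmax.
split; first exact: cvg_in_probP.
apply: cvg_in_probP => e e0.
(* [e / 16] matches the constant 8 of [hessian_add_ln] and [2^-1] its admissible range; the other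
   [e / 2] is spent on the continuity of the Hessian of [H]. *)
pose r := Num.min 2^-1 (e / 16).
have r0 : 0 < r by rewrite lt_min invr_gt0 ltr0n divr_gt0.
have r2 : r <= 2^-1 by rewrite ge_min lexx.
have re : 8 * r <= e / 2.
  have : r <= e / 16 by rewrite ge_min lexx orbT.
  lra.
have e20 : 0 < e / 2 by rewrite divr_gt0.
have [s [s0 sU hs]] := lln_loc _ _ Ts0 r0.
pose U := [set t : 'rV[R]_p | forall i, `|t ord0 i - lsubmx x0 ord0 i| < s].
have oU : open U by exact: open_box.
have oOv : open Ov by exact: (model_open mdl).
have sh' : smooth (joint_set U Ov) 3 H.
  by apply: smooth_sub sh => z [/sU].
have nJ : nbhs x0 (joint_set U Ov).
  apply: open_nbhs_nbhs; split; first exact: open_joint_set.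
  by split=> // i; rewrite subrr normr0.
have nH1 (ij : 'I_(p + d) * 'I_(p + d)) : \forall x \near x0,
    `|partial ij.1 (partial ij.2 H) x0 - partial ij.1 (partial ij.2 H) x| <
    e / 2.
  have cH := smooth_continuous
    (smooth_partial ij.1 (smooth_partial ij.2 sh)) (conj Ts0 Os0).
  by have /cvgrPdist_lt/(_ _ e20) := cH.
have nH := @filter_forall _ _ _ (nbhs x0) (nbhs_filter x0) nH1.
(* In this ball the estimator stays where the averages are controlled, and the entries of the
   Hessian of [H] are within [e / 2] of those at [x0]. *)
have [rho /= rho0 hrho] := (nbhs_ballP _ _).1 (filterI nJ nH).
apply: whp_sub (whp_and hs (X_near _ rho0)) => B w [hB hX].
have /hrho[JX HX] : ball x0 rho (X B w) by rewrite -ball_normE /= distrC.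
apply: mx_norm_lt => // i j.
have dG k u : U u -> is_derive u (delta_mx ord0 k) (mean B (V ^~ w))
    (weighted_mean q B (V ^~ w) (fun v => partial k (g ^~ v) u)).
  move=> Uu; exact: (weighted_mean_partial (q : borelV R d -> R) rg B (V ^~ w) k
    (sU u Uu)).
have dG2 k l u : U u ->
    is_derive u (delta_mx ord0 k) (partial l (mean B (V ^~ w)))
    (weighted_mean q B (V ^~ w) (fun v => partial k (partial l (g ^~ v)) u)).
  move=> Uu; exact: (weighted_mean_partial2 (q : borelV R d -> R) oT rg B
    (V ^~ w) k l (sU u Uu)).
have bG u : U u -> [/\ `|mean B (V ^~ w) u - 1| < r,
    forall k, `|partial k (mean B (V ^~ w)) u| < r &
    forall k l, `|partial k (partial l (mean B (V ^~ w))) u| < r].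
  move=> Uu; have [h0 h1 h2] := hB u Uu; split=> // [k|k l].
    by have [_ Dk] := dG k u Uu; rewrite [partial _ _ _]Dk.
  by have [_ Dk] := dG2 k l u Uu; rewrite [partial _ _ _]Dk.
have FE z : U (lsubmx z) -> HB B w z = H z + ln (mean B (V ^~ w) (lsubmx z)).
  move=> Uz; have [h _ _] := bG _ Uz.
  by apply: HBE; [exact/sT/sU | exact: mean0 r2 h].
have hess := hessian_add_ln oU oOv JX sh' FE (introT andP (conj r0 r2))
  (fun k u Uu => let: DeriveDef D _ := dG k u Uu in D)
  (fun k l u Uu => let: DeriveDef D _ := dG2 k l u Uu in D) bG i j.
have hcont := HX (i, j).
have entry (F G : 'rV[R]_(p + d) -> R) x z :
    (- hessian F x - - hessian G z) i j =
    - (partial i (partial j F) x - partial i (partial j G) z).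
  by rewrite !mxE opprD.
rewrite [X in `|X|]entry normrN.
(* The intermediate term is the Hessian of [H] at the estimator: the objective changes first, then
   the point. *)
have := ler_distD (partial i (partial j H) (X B w))
  (partial i (partial j (HB B w)) (X B w)) (partial i (partial j H) x0).
move=> /le_lt_trans; apply; rewrite (_ : e = e / 2 + e / 2); last by field.
apply: ltrD; first exact: lt_le_trans hess re.
by rewrite distrC; exact: hcont.
Qed.
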